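(* Let $R$ be a one-dimensional commutative Noetherian local ring whose completion (with respect to its maximal ideal) is reduced. Let $\mathcal C(R)$ denote the conductor of $R$ in $\overline R$. Then $$\mathcal C(R)=\bigcap_{i>0,\ M,N\in \operatorname{CM}_0(R)} \operatorname{ann}_R \operatorname{Tor}^R_i(M,N)=\bigcap_{i>0,\ M,N\in \operatorname{CM}_0(R)} \operatorname{ann}_R \operatorname{Ext}^i_R(M,N)=\bigcap_{i>1,\ M,N\in \operatorname{CM}_0(R)} \operatorname{ann}_R \operatorname{Ext}^i_R(M,N).$$
   Context: $Q(R)$ is the total ring of fractions of $R$ (the localization of $R$ at all its non-zero-divisors), and $\overline R$ is the integral closure of $R$ in $Q(R)$. The conductor is $\mathcal C(R)=(R:\overline R)=\{x\in Q(R): x\overline R\subseteq R\}$, which is an ideal of $R$. A finitely generated $R$-module $M$ is called maximal Cohen--Macaulay if $\operatorname{depth}_{R_{\mathfrak p}}M_{\mathfrak p}=\dim R_{\mathfrak p}$ for all $\mathfrak p\in\operatorname{Supp}_R M$ (so the zero module is included). $\operatorname{CM}_0(R)$ is the full subcategory of all maximal Cohen--Macaulay $R$-modules $M$ such that $M_{\mathfrak p}$ is a free $R_{\mathfrak p}$-module for every non-maximal prime ideal $\mathfrak p$ of $R$. For an $R$-module $X$, $\operatorname{ann}_R X=\{r\in R: rX=0\}$. *)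

(* Defs.v *)
From HB Require Import structures.
From mathcomp Require Import all_boot all_algebra.
From mathcomp Require Import finmap boolp classical_sets functions.
From mathcomp Require Import monalg ring.

Set Implicit Arguments.
Unset Strict Implicit.
Unset Printing Implicit Defensive.

Import GRing.Theory.

Local Open Scope ring_scope.
Local Open Scope quotient_scope.
Local Open Scope classical_set_scope.

Section Submodule.
Variables (R : comNzRingType) (M : lmodType R).

Record submodule := Submodule {
  carrier : set M;
  _ : carrier 0;
  _ : forall a x y,
        carrier x -> carrier y -> carrier (a *: x + y) }.

Variable S : submodule.

Definition in_submodule : {pred M} := fun x => `[< carrier S x >].

Lemma in_submodule_closed : submod_closed in_submodule.
Proof.
rewrite /in_submodule; case: S => A A0 AD; split; first exact/asboolP.
by move=> a x y /asboolP Ax /asboolP Ay; apply/asboolP/AD.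
Qed.

HB.instance Definition _ := GRing.isSubmodClosed.Build R M in_submodule
  (GRing.submod_closed_semi in_submodule_closed).

Definition submod : Type := {x : M | in_submodule x}.
HB.instance Definition _ := SubChoice.on submod.
HB.instance Definition _ := [SubChoice_isSubLmodule of submod by <:].

Definition quotmod : Type := Quotient.quot in_submodule.
HB.instance Definition _ := GRing.Zmodule.on quotmod.

Definition quotmod_pi (x : M) : quotmod := \pi_(Quotient.quot in_submodule) x.

Lemma quotmod_piP x y : quotmod_pi x = quotmod_pi y <-> carrier S (x - y).
Proof.
rewrite /quotmod_pi; split.
  by move/eqP; rewrite -Quotient.idealrBE => /asboolP.
by move=> Sxy; apply/eqP; rewrite -Quotient.idealrBE; apply/asboolP.
Qed.

Lemma quotmod_reprK (u : quotmod) :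
  quotmod_pi (repr (u : Quotient.quot in_submodule)) = u.
Proof. exact: (reprK (u : Quotient.quot in_submodule)). Qed.

Lemma quotmod_piD : {morph quotmod_pi : x y / x + y}.
Proof. by move=> x y; rewrite /quotmod_pi raddfD. Qed.

Definition quotmod_scale (a : R) (u : quotmod) : quotmod :=
  quotmod_pi (a *: repr (u : Quotient.quot in_submodule)).

Lemma quotmod_piZ a x : quotmod_scale a (quotmod_pi x) = quotmod_pi (a *: x).
Proof.
apply/quotmod_piP; rewrite -scalerBr; apply/asboolP.
change (a *: (repr (quotmod_pi x : Quotient.quot in_submodule) - x)
  \in in_submodule).
by apply: rpredZ; apply/asboolP/quotmod_piP; rewrite quotmod_reprK.
Qed.

Lemma quotmod_scaleA a b u :
  quotmod_scale a (quotmod_scale b u) = quotmod_scale (a * b) u.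
Proof. by rewrite -[u]quotmod_reprK !quotmod_piZ scalerA. Qed.

Lemma quotmod_scale1 : left_id 1 quotmod_scale.
Proof. by move=> u; rewrite -[u]quotmod_reprK !quotmod_piZ scale1r. Qed.

Lemma quotmod_scaleDr : right_distributive quotmod_scale +%R.
Proof.
move=> a u v; rewrite -[u]quotmod_reprK -[v]quotmod_reprK.
by rewrite -quotmod_piD !quotmod_piZ -quotmod_piD scalerDr.
Qed.

Lemma quotmod_scaleDl u : {morph quotmod_scale^~ u : a b / a + b}.
Proof.
move=> a b; rewrite -[u]quotmod_reprK !quotmod_piZ.
by rewrite -quotmod_piD scalerDl.
Qed.

HB.instance Definition _ := GRing.Zmodule_isLmodule.Build R quotmod
  quotmod_scaleA quotmod_scale1 quotmod_scaleDr quotmod_scaleDl.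

Lemma quotmod_pi_linear : linear quotmod_pi.
Proof. by move=> a x y; rewrite quotmod_piD -quotmod_piZ. Qed.

HB.instance Definition _ :=
  GRing.isLinear.Build R M quotmod *:%R quotmod_pi quotmod_pi_linear.

End Submodule.

Section SubmoduleTheory.
Variables (R : comNzRingType) (M : lmodType R) (S : submodule M).

Lemma carrier0 : carrier S 0.
Proof. by case: S. Qed.

Lemma carrierP a x y : carrier S x -> carrier S y -> carrier S (a *: x + y).
Proof. by case: S => A A0 AP; exact: AP. Qed.

Lemma carrierD x y : carrier S x -> carrier S y -> carrier S (x + y).
Proof. by rewrite -{2}[x]scale1r; exact: carrierP. Qed.

Lemma carrierZ a x : carrier S x -> carrier S (a *: x).
Proof. by move=> Sx; rewrite -[_ *: _]addr0; apply: carrierP carrier0. Qed.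

Lemma carrierB x y : carrier S x -> carrier S y -> carrier S (x - y).
Proof. by move=> Sx Sy; rewrite addrC -scaleN1r; exact: carrierP. Qed.

End SubmoduleTheory.

Section Span.
Variables (R : comNzRingType) (M : lmodType R) (A : set M).

Definition span_set : set M :=
  [set x | forall S : submodule M, A `<=` carrier S -> carrier S x].

Lemma span_set0 : span_set 0.
Proof. by move=> S _; exact: carrier0. Qed.

Lemma span_setP a x y : span_set x -> span_set y -> span_set (a *: x + y).
Proof. by move=> Ax Ay S AS; apply: carrierP; [exact: Ax|exact: Ay]. Qed.

Definition span : submodule M := Submodule span_set0 span_setP.

End Span.

Section Annihilator.
Variables (R : comNzRingType) (M : lmodType R).

Definition ann : set R := [set r | forall x : M, r *: x = 0].

Definition finitely_generated : Prop :=
  exists s : seq M, carrier (span [set` s]) = setT.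

End Annihilator.

Section Homology.
Variables (R : comNzRingType) (A B C : lmodType R).
Variables (f : {linear A -> B}) (g : {linear B -> C}).

Definition ker_set : set B := [set x | g x = 0].

Lemma ker_set0 : ker_set 0.
Proof. exact: raddf0. Qed.

Lemma ker_setP a x y : ker_set x -> ker_set y -> ker_set (a *: x + y).
Proof. by rewrite /ker_set /= linearP => -> ->; rewrite scaler0 addr0. Qed.

Definition ker : submodule B := Submodule ker_set0 ker_setP.

Definition boundary_set : set (submod ker) :=
  [set z | exists x, f x = val z].

Lemma boundary_set0 : boundary_set 0.
Proof. by exists 0; rewrite !raddf0. Qed.

Lemma boundary_setP a x y :
  boundary_set x -> boundary_set y -> boundary_set (a *: x + y).
Proof.
by move=> [x' fx'] [y' fy']; exists (a *: x' + y'); rewrite !linearP fx' fy'.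
Qed.

Definition boundary : submodule (submod ker) :=
  Submodule boundary_set0 boundary_setP.

(** The homology [ker g / im f] at [B] of [A --f--> B --g--> C]. *)
Definition homology : lmodType R := quotmod boundary.

End Homology.

Section FreeExt.
Variables (R : comNzRingType) (X : choiceType) (M : lmodType R) (h : X -> M).

(** [{malg R[X]}], the finitely supported functions [X -> R], is the free
    module on [X], and [free_ext] is the linear extension of [h] to it. *)
Definition free_ext (u : {malg R[X]}) : M := \sum_(k <- msupp u) u@_k *: h k.

Lemma free_ext_sum (E : {fset X}) u : (msupp u `<=` E)%fset ->
  free_ext u = \sum_(k <- E) u@_k *: h k.
Proof.
move=> le; rewrite /free_ext (big_fset_incl _ le) //= => x xd.
by move/mcoeff_outdom ->; rewrite scale0r.
Qed.

Lemma free_ext_linear : linear free_ext.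
Proof.
move=> a u v; pose E := (msupp (a *: u + v) `|` (msupp u `|` msupp v))%fset.
have lev : (msupp v `<=` E)%fset by rewrite /E !fsubsetU ?fsubset_refl ?orbT.
have leu : (msupp u `<=` E)%fset by rewrite /E !fsubsetU ?fsubset_refl ?orbT.
rewrite (free_ext_sum (E := E)) ?fsubsetUl // (free_ext_sum leu).
rewrite (free_ext_sum lev) scaler_sumr -big_split /=; apply: eq_bigr => k _.
by rewrite mcoeffD mcoeffZ scalerDl scalerA.
Qed.

HB.instance Definition _ :=
  GRing.isLinear.Build R {malg R[X]} M *:%R free_ext free_ext_linear.

Lemma free_extU k : free_ext << k >> = h k.
Proof.
by rewrite (free_ext_sum msuppU_le) big_seq_fset1 mcoeffUU scale1r.
Qed.

End FreeExt.

Definition is_free (R : comNzRingType) (M : lmodType R) : Prop :=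
  exists (X : choiceType) (f : {linear {malg R[X]} -> M}), bijective f.

Section Tensor.
Variables (R : comNzRingType) (M N : lmodType R).

Inductive tensor_rel : set {malg R[(M * N)%type]} :=
| TensorDl x x' y :
    tensor_rel (<< (x + x', y) >> - << (x, y) >> - << (x', y) >>)
| TensorDr x y y' :
    tensor_rel (<< (x, y + y') >> - << (x, y) >> - << (x, y') >>)
| TensorZl a x y :
    tensor_rel (<< (a *: x, y) >> - a *: << (x, y) >>)
| TensorZr a x y :
    tensor_rel (<< (x, a *: y) >> - a *: << (x, y) >>).

Definition tensor : lmodType R := quotmod (span tensor_rel).

Definition tmk (x : M) (y : N) : tensor :=
  quotmod_pi (span tensor_rel) << (x, y) >>.

Lemma span_tensor_rel u : tensor_rel u -> carrier (span tensor_rel) u.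
Proof. by move=> ru S; apply. Qed.

Lemma tmkDl x x' y : tmk (x + x') y = tmk x y + tmk x' y.
Proof.
rewrite /tmk -raddfD; apply/quotmod_piP; apply: span_tensor_rel.
rewrite opprD addrA; exact: TensorDl.
Qed.

Lemma tmkDr x y y' : tmk x (y + y') = tmk x y + tmk x y'.
Proof.
rewrite /tmk -raddfD; apply/quotmod_piP; apply: span_tensor_rel.
rewrite opprD addrA; exact: TensorDr.
Qed.

Lemma tmkZl a x y : tmk (a *: x) y = a *: tmk x y.
Proof.
rewrite /tmk -linearZ; apply/quotmod_piP; apply: span_tensor_rel.
exact: TensorZl.
Qed.

Lemma tmkZr a x y : tmk x (a *: y) = a *: tmk x y.
Proof.
rewrite /tmk -linearZ; apply/quotmod_piP; apply: span_tensor_rel.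
exact: TensorZr.
Qed.

End Tensor.

Section TensorMap.
Variables (R : comNzRingType) (M M' N : lmodType R) (f : {linear M -> M'}).

Definition tensor_pre (u : {malg R[(M * N)%type]}) : tensor M' N :=
  free_ext (fun p : M * N => tmk (f p.1) p.2) u.

Definition tensor_map (t : tensor M N) : tensor M' N :=
  tensor_pre
    (repr (t : Quotient.quot (in_submodule (span (@tensor_rel R M N))))).

Lemma tensor_pre_rel u :
  carrier (span (@tensor_rel R M N)) u -> tensor_pre u = 0.
Proof.
pose g : {linear {malg R[(M * N)%type]} -> tensor M' N} :=
  free_ext (fun p : M * N => tmk (f p.1) p.2).
have gU p : g << p >> = tmk (f p.1) p.2 by exact: free_extU.
suff g0 v : tensor_rel v -> g v = 0 by move/(_ (ker g) g0).
case=> [x x' y|x y y'|a x y|a x y].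
- rewrite 2!(linearB g) !gU /= linearD tmkDl.
  by rewrite [_ + tmk (f x') y]addrC addrK subrr.
- by rewrite 2!(linearB g) !gU /= tmkDr [_ + tmk _ y']addrC addrK subrr.
- by rewrite (linearB g) (linearZZ g) !gU /= linearZ tmkZl subrr.
- by rewrite (linearB g) (linearZZ g) !gU /= tmkZr subrr.
Qed.

Lemma tensor_map_pi u :
  tensor_map (quotmod_pi (span (@tensor_rel R M N)) u) = tensor_pre u.
Proof.
apply/eqP; rewrite -subr_eq0 /tensor_map /tensor_pre -linearB /=; apply/eqP.
apply: tensor_pre_rel; apply/quotmod_piP.
by rewrite quotmod_reprK.
Qed.

Lemma tensor_map_linear : linear tensor_map.
Proof.
move=> a u v; rewrite -[u]quotmod_reprK -[v]quotmod_reprK -linearP.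
by rewrite !tensor_map_pi /tensor_pre linearP.
Qed.

(** [f (x) id_N] *)
HB.instance Definition _ := GRing.isLinear.Build R (tensor M N) (tensor M' N)
  *:%R tensor_map tensor_map_linear.

Lemma tensor_mapE x y : tensor_map (tmk x y) = tmk (f x) y.
Proof. by rewrite tensor_map_pi /tensor_pre free_extU. Qed.

End TensorMap.

Arguments tensor_map {R M M'} N f t.

Section Hom.
Variables (R : comNzRingType) (M N : lmodType R).

Definition hom_set : set (M -> N) := [set f | linear f].

Lemma hom_set0 : hom_set 0.
Proof. by move=> a x y /=; rewrite scaler0 addr0. Qed.

Lemma hom_setP a f g : hom_set f -> hom_set g -> hom_set (a *: f + g).
Proof.
move=> lf lg b x y; rewrite -[LHS]/(a *: f (b *: x + y) + g (b *: x + y)).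
rewrite -[RHS]/(b *: (a *: f x + g x) + (a *: f y + g y)) lf lg.
by rewrite !scalerDr !scalerA [b * a]mulrC addrACA.
Qed.

Definition hom : lmodType R := submod (Submodule hom_set0 hom_setP).

End Hom.

Section HomMap.
Variables (R : comNzRingType) (M M' N : lmodType R) (f : {linear M -> M'}).

Lemma hom_map_subproof (h : hom M' N) :
  in_submodule (Submodule (@hom_set0 R M N) (@hom_setP R M N)) (val h \o f).
Proof.
case: h => h /= /asboolP lh; apply/asboolP => a x y /=.
by rewrite linearP lh.
Qed.

Definition hom_map (h : hom M' N) : hom M N := Sub _ (hom_map_subproof h).

Lemma hom_map_linear : linear hom_map.
Proof. by move=> a g h; apply/val_inj. Qed.

(** Precomposition with [f]: [Hom (M', N) -> Hom (M, N)]. *)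
HB.instance Definition _ := GRing.isLinear.Build R (hom M' N) (hom M N)
  *:%R hom_map hom_map_linear.

End HomMap.

Arguments hom_map {R M M'} N f h.

Section TorExt.
Variable R : comNzRingType.

(** The presentation [{malg R[M]} -> M] of [M] by the free module on the
    underlying set of [M]. *)
Definition free_cover (M : lmodType R) : {linear {malg R[M]} -> M} :=
  free_ext (fun x : M => x).

Fixpoint syzygy (M : lmodType R) (n : nat) : lmodType R :=
  if n is n'.+1 then submod (ker (free_cover (syzygy M n'))) else M.

(** The standard free resolution [... -> F_2 -> F_1 -> F_0 -> M -> 0]:
    [F_n] is free on the underlying set of the [n]-th syzygy module, which is
    the kernel of [F_(n-1) -> F_(n-2)] (of [F_0 -> M] if [n = 1]). *)
Definition resolution (M : lmodType R) (n : nat) : lmodType R :=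
  {malg R[syzygy M n]}.

(** [resolution_d M n : F_n -> F_(n-1)], with the convention that it is the
    zero map [F_0 -> F_0] when [n = 0]. *)
Definition resolution_d (M : lmodType R) (n : nat) :
    {linear resolution M n -> resolution M n.-1} :=
  if n is n'.+1 then
    val \o free_cover (submod (ker (free_cover (syzygy M n'))))
  else \0.

(** The standard resolution fixes one representative of each isomorphism class;
    [Tor_i (M, N)] and [Ext^i (M, N)] do not depend on it up to isomorphism, so
    their annihilators do not depend on it at all. *)
Definition Tor (i : nat) (M N : lmodType R) : lmodType R :=
  homology (tensor_map N (resolution_d M i.+1))
           (tensor_map N (resolution_d M i)).

Definition Ext (i : nat) (M N : lmodType R) : lmodType R :=
  homology (hom_map N (resolution_d M i))
           (hom_map N (resolution_d M i.+1)).

End TorExt.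

Section Ideals.
Variable R : comNzRingType.

Definition ideal := submodule R^o.

Definition ideal_gen (A : set R) : ideal := @span R R^o A.

Implicit Types I J p m : ideal.

Definition prime_ideal p : Prop :=
  ~ carrier p (1 : R) /\
  forall x y : R, carrier p (x * y) -> carrier p x \/ carrier p y.

Definition maximal_ideal m : Prop :=
  ~ carrier m (1 : R) /\
  forall I, carrier m `<=` carrier I -> ~ carrier I (1 : R) ->
    carrier I `<=` carrier m.

Definition is_noetherian : Prop :=
  forall I, exists s : seq R, carrier I = carrier (ideal_gen [set` s]).

Definition is_local m : Prop :=
  maximal_ideal m /\ forall m', maximal_ideal m' -> carrier m' = carrier m.

Definition prime_chain (n : nat) (c : nat -> ideal) : Prop :=
  (forall i, (i <= n)%N -> prime_ideal (c i)) /\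
  (forall i, (i < n)%N -> carrier (c i) `<` carrier (c i.+1)).

Definition krull_dim (d : nat) : Prop :=
  (exists c, prime_chain d c) /\
  (forall n c, prime_chain n c -> (n <= d)%N).

Definition ideal_exp I (n : nat) : ideal :=
  ideal_gen [set x | exists2 f : 'I_n -> R,
                       forall i, carrier I (f i) & x = \prod_i f i].

Record primeSpec := PrimeSpec {
  prime_val : ideal;
  prime_valP : prime_ideal prime_val }.

End Ideals.

Definition is_reduced (A : comPzRingType) : Prop :=
  forall (x : A) (n : nat), x ^+ n = 0 -> x = 0.

Section Completion.
Variables (R : comNzRingType) (m : ideal R).

Lemma ideal_expM n (a x : R) :
  carrier (ideal_exp m n) x -> carrier (ideal_exp m n) (a * x).
Proof. exact: (@carrierZ R R^o). Qed.

(** The [m]-adic completion, as Cauchy sequences modulo null sequences. *)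
Definition is_cauchy (u : nat -> R) : Prop :=
  forall n, exists k, forall i j, (k <= i)%N -> (k <= j)%N ->
    carrier (ideal_exp m n) (u i - u j).

Definition is_null (u : nat -> R) : Prop :=
  forall n, exists k, forall i, (k <= i)%N -> carrier (ideal_exp m n) (u i).

Definition cauchy_pred : {pred (nat -> R)} := fun u => `[< is_cauchy u >].

Lemma cauchy_subring : subring_closed cauchy_pred.
Proof.
split.
- apply/asboolP => n; exists 0%N => i j _ _; rewrite subrr.
  exact: carrier0.
- move=> u v /asboolP cu /asboolP cv; apply/asboolP => n.
  have [k uk] := cu n; have [l vl] := cv n; exists (maxn k l) => i j.
  rewrite !geq_max => /andP[ki li] /andP[kj lj].
  rewrite (_ : _ - _ = (u i - u j) - (v i - v j)); first last.
    by rewrite -[LHS]/(u i - v i - (u j - v j)) !opprD !opprK addrACA.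
  by apply: carrierB; [exact: uk|exact: vl].
- move=> u v /asboolP cu /asboolP cv; apply/asboolP => n.
  have [k uk] := cu n; have [l vl] := cv n; exists (maxn k l) => i j.
  rewrite !geq_max => /andP[ki li] /andP[kj lj].
  rewrite (_ : _ - _ = u i * (v i - v j) + v j * (u i - u j)).
    by apply: carrierD; apply: ideal_expM; [exact: vl|exact: uk].
  rewrite -[LHS]/(u i * v i - u j * v j) !mulrBr addrA.
  by rewrite [v j * u i]mulrC subrK [v j * _]mulrC.
Qed.

HB.instance Definition _ :=
  GRing.isSubringClosed.Build (nat -> R) cauchy_pred cauchy_subring.

Definition cauchy_seq : Type := {u : nat -> R | cauchy_pred u}.
HB.instance Definition _ := SubChoice.on cauchy_seq.
HB.instance Definition _ := GRing.SubChoice_isSubComPzRing.Build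
  (nat -> R) cauchy_pred cauchy_seq cauchy_subring.

Definition null_pred : {pred cauchy_seq} := fun u => `[< is_null (val u) >].

Lemma null_zmod : zmod_closed null_pred.
Proof.
split.
- by apply/asboolP => n; exists 0%N => i _; exact: carrier0.
- move=> u v /asboolP cu /asboolP cv; apply/asboolP => n.
  have [k uk] := cu n; have [l vl] := cv n; exists (maxn k l) => i.
  rewrite !geq_max => /andP[ki li].
  by apply: carrierB; [exact: uk|exact: vl].
Qed.

HB.instance Definition _ :=
  GRing.isZmodClosed.Build cauchy_seq null_pred null_zmod.

Lemma null_predM u v : v \in null_pred -> u * v \in null_pred.
Proof.
move=> /asboolP nv; apply/asboolP => n; have [k vk] := nv n.
by exists k => i /vk /ideal_expM; apply.
Qed.

Definition completion : Type := Quotient.quot null_pred.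
HB.instance Definition _ := GRing.Zmodule.on completion.

Definition completion_pi (u : cauchy_seq) : completion :=
  \pi_(Quotient.quot null_pred) u.

Lemma completion_piP u v :
  completion_pi u = completion_pi v <-> u - v \in null_pred.
Proof.
rewrite /completion_pi Quotient.idealrBE.
by split=> [->|/eqP].
Qed.

Lemma completion_reprK (x : completion) :
  completion_pi (repr (x : Quotient.quot null_pred)) = x.
Proof. exact: (reprK (x : Quotient.quot null_pred)). Qed.

Lemma completion_piD : {morph completion_pi : u v / u + v}.
Proof. by move=> u v; rewrite /completion_pi raddfD. Qed.

Definition completion_mul (x y : completion) : completion :=
  completion_pi (repr (x : Quotient.quot null_pred)
                 * repr (y : Quotient.quot null_pred)).

Lemma completion_piM u v :
  completion_mul (completion_pi u) (completion_pi v) = completion_pi (u * v).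
Proof.
apply/completion_piP; set u' := repr _; set v' := repr _.
have nu : u' - u \in null_pred by apply/completion_piP/completion_reprK.
have nv : v' - v \in null_pred by apply/completion_piP/completion_reprK.
rewrite (_ : _ - _ = u' * (v' - v) + v * (u' - u)).
  by apply: rpredD; apply: null_predM.
by rewrite !mulrBr addrA [v * u']mulrC subrK [v * u]mulrC.
Qed.

Lemma completion_mulA : associative completion_mul.
Proof.
move=> x y z; rewrite -[x]completion_reprK -[y]completion_reprK.
by rewrite -[z]completion_reprK !completion_piM mulrA.
Qed.

Lemma completion_mulC : commutative completion_mul.
Proof.
move=> x y; rewrite -[x]completion_reprK -[y]completion_reprK.
by rewrite !completion_piM mulrC.
Qed.

Lemma completion_mul1 : left_id (completion_pi 1) completion_mul.
Proof. by move=> x; rewrite -[x]completion_reprK !completion_piM mul1r. Qed.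

Lemma completion_mulDl : left_distributive completion_mul +%R.
Proof.
move=> x y z; rewrite -[x]completion_reprK -[y]completion_reprK.
rewrite -[z]completion_reprK -completion_piD !completion_piM.
by rewrite -completion_piD mulrDl.
Qed.

HB.instance Definition _ := GRing.Zmodule_isComPzRing.Build completion
  completion_mulA completion_mulC completion_mul1 completion_mulDl.

End Completion.

Section Localization.
Variable R : comNzRingType.

(** [0] is excluded so that every [S^-1 R] is a nonzero ring. *)
Record mulset := MulSet {
  mulset_carrier :> set R;
  mulset1 : mulset_carrier 1;
  mulsetM : forall s t,
    mulset_carrier s -> mulset_carrier t -> mulset_carrier (s * t);
  mulset0 : ~ mulset_carrier 0 }.

Variable S : mulset.

Record denom := Denom { dval : R; dvalP : `[< mulset_carrier S dval >] }.
HB.instance Definition _ := [isSub for dval].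
HB.instance Definition _ := [Choice of denom by <:].

Definition denom1 : denom := Denom (asboolT (mulset1 S)).
Definition denomM (s t : denom) : denom :=
  Denom (asboolT (mulsetM (asboolW (dvalP s)) (asboolW (dvalP t)))).

Section Module.
Variable M : lmodType R.

(** [x / s = y / t] iff [u (t x - s y) = 0] for some [u] in [S]. *)
Definition frac_equiv (p q : M * denom) : bool :=
  `[< exists u : denom,
        dval u *: (dval q.2 *: p.1) = dval u *: (dval p.2 *: q.1) >].

Lemma frac_equiv_class : equiv_class_of frac_equiv.
Proof.
split=> [p|p q|q p r].
- by apply/asboolP; exists denom1.
- by apply/asboolP/asboolP => -[u e]; exists u.
- move=> /asboolP[u e] /asboolP[v f]; apply/asboolP.
  exists (denomM (denomM u v) q.2) => /=.
  have -> : dval u * dval v * dval q.2 *: (dval r.2 *: p.1)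
      = (dval v * dval r.2) *: (dval u *: (dval q.2 *: p.1)).
    by rewrite !scalerA; congr (_ *: _); ring.
  rewrite e.
  have -> : (dval v * dval r.2) *: (dval u *: (dval p.2 *: q.1))
      = (dval u * dval p.2) *: (dval v *: (dval r.2 *: q.1)).
    by rewrite !scalerA; congr (_ *: _); ring.
  by rewrite f !scalerA; congr (_ *: _); ring.
Qed.

Canonical frac_equiv_rel := EquivRelPack frac_equiv_class.
Canonical frac_enc_mod_rel := defaultEncModRel frac_equiv.

Definition locmod : Type := {eq_quot frac_equiv}.
HB.instance Definition _ := Choice.on locmod.

Definition frac (x : M) (s : denom) : locmod :=
  \pi_({eq_quot frac_equiv}) (x, s).

Lemma fracP x s y t :
  frac x s = frac y t <->
  exists u : denom, dval u *: (dval t *: x) = dval u *: (dval s *: y).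
Proof.
split; first by move/eqmodP => /asboolP.
by move=> e; apply/eqmodP/asboolP.
Qed.

Lemma frac_ind (P : locmod -> Prop) :
  (forall x s, P (frac x s)) -> forall u, P u.
Proof.
move=> Pf u; rewrite -[u](reprK (u : {eq_quot frac_equiv})).
by case: (repr _) => x s; exact: Pf.
Qed.

Definition num (u : locmod) : M := (repr (u : {eq_quot frac_equiv})).1.
Definition den (u : locmod) : denom := (repr (u : {eq_quot frac_equiv})).2.

Lemma fracK u : frac (num u) (den u) = u.
Proof.
rewrite /frac /num /den -surjective_pairing.
exact: (reprK (u : {eq_quot frac_equiv})).
Qed.

Definition locmod_add (u v : locmod) : locmod :=
  frac (dval (den v) *: num u + dval (den u) *: num v) (denomM (den u) (den v)).
Definition locmod_opp (u : locmod) : locmod := frac (- num u) (den u).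

Lemma frac_add x s y t : locmod_add (frac x s) (frac y t) =
  frac (dval t *: x + dval s *: y) (denomM s t).
Proof.
have /fracP[u e] := fracK (frac x s); have /fracP[v f] := fracK (frac y t).
set x' := num (frac x s) in e *; set s' := den (frac x s) in e *.
set y' := num (frac y t) in f *; set t' := den (frac y t) in f *.
apply/fracP; exists (denomM u v) => /=.
rewrite !scalerDr; congr (_ + _).
- have -> : dval u * dval v *: (dval s * dval t *: (dval t' *: x'))
      = (dval v * dval t * dval t') *: (dval u *: (dval s *: x')).
    by rewrite !scalerA; congr (_ *: _); ring.
  by rewrite e !scalerA; congr (_ *: _); ring.
- have -> : dval u * dval v *: (dval s * dval t *: (dval s' *: y'))
      = (dval u * dval s * dval s') *: (dval v *: (dval t *: y')).
    by rewrite !scalerA; congr (_ *: _); ring.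
  by rewrite f !scalerA; congr (_ *: _); ring.
Qed.

Lemma frac_opp x s : locmod_opp (frac x s) = frac (- x) s.
Proof.
have /fracP[u e] := fracK (frac x s).
by apply/fracP; exists u; rewrite !scalerN e.
Qed.

Lemma locmod_addA : associative locmod_add.
Proof.
elim/frac_ind => x s; elim/frac_ind => y t; elim/frac_ind => z r.
rewrite !frac_add; apply/fracP; exists denom1; congr (_ *: _) => /=.
by rewrite !scalerDr !scalerA addrA; congr (_ *: _ + _ *: _ + _ *: _); ring.
Qed.

Lemma locmod_addC : commutative locmod_add.
Proof.
elim/frac_ind => x s; elim/frac_ind => y t.
rewrite !frac_add; apply/fracP; exists denom1; congr (_ *: _) => /=.
by rewrite addrC [dval t * _]mulrC.
Qed.

Lemma locmod_add0 : left_id (frac 0 denom1) locmod_add.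
Proof.
elim/frac_ind => x s; rewrite !frac_add; apply/fracP; exists denom1.
by rewrite /= scaler0 add0r !scale1r mul1r.
Qed.

Lemma locmod_addN : left_inverse (frac 0 denom1) locmod_opp locmod_add.
Proof.
elim/frac_ind => x s; rewrite frac_opp frac_add; apply/fracP; exists denom1.
by rewrite /= scalerN addNr !scaler0.
Qed.

HB.instance Definition _ := GRing.isZmodule.Build locmod
  locmod_addA locmod_addC locmod_add0 locmod_addN.

Lemma fracD x s y t :
  frac x s + frac y t = frac (dval t *: x + dval s *: y) (denomM s t).
Proof. exact: frac_add. Qed.

End Module.

(** [S^-1 R] is [S^-1 M] for the regular module [M = R^o]; only [loc] carries
    the ring structure, over which every [locmod M] is a module. *)
Definition loc : Type := locmod R^o.
HB.instance Definition _ := GRing.Zmodule.on loc.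

Definition rfrac (a : R) (s : denom) : loc := @frac R^o a s.

Section Scale.
Variable M : lmodType R.

Definition locmod_scale (c : loc) (u : locmod M) : locmod M :=
  frac ((num c : R) *: num u) (denomM (den c) (den u)).

Lemma frac_scale a s x t :
  locmod_scale (rfrac a s) (frac x t) = frac (a *: x) (denomM s t).
Proof.
have /fracP[u e] := fracK (rfrac a s); have /fracP[v f] := fracK (frac x t).
set a' := num (rfrac a s) in e *; set s' := den (rfrac a s) in e *.
set x' := num (frac x t) in f *; set t' := den (frac x t) in f *.
have {}e : dval u * (dval s * (a' : R)) = dval u * (dval s' * a) by [].
rewrite /locmod_scale -/a' -/s' -/x' -/t'.
apply/fracP; exists (denomM u v) => /=.
have -> : dval u * dval v *: (dval s * dval t *: ((a' : R) *: x'))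
    = (dval u * (dval s * (a' : R))) *: (dval v *: (dval t *: x')).
  by rewrite !scalerA; congr (_ *: _); ring.
by rewrite e f !scalerA; congr (_ *: _); ring.
Qed.

End Scale.

Definition loc_one : loc := rfrac 1 denom1.
Definition loc_mul (c d : loc) : loc := locmod_scale c d.

Lemma rfrac_mul a s b t :
  loc_mul (rfrac a s) (rfrac b t) = rfrac (a * b) (denomM s t).
Proof. exact: (@frac_scale R^o). Qed.

Lemma rfracP a s b t : rfrac a s = rfrac b t <->
  exists u : denom, dval u * (dval t * a) = dval u * (dval s * b).
Proof. exact: (@fracP R^o). Qed.

Lemma rfrac_ind (P : loc -> Prop) :
  (forall a s, P (rfrac a s)) -> forall c, P c.
Proof. exact: (@frac_ind R^o). Qed.

Lemma rfracD a s b t :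
  rfrac a s + rfrac b t = rfrac (dval t * a + dval s * b) (denomM s t).
Proof. exact: (@fracD R^o). Qed.

Lemma loc_mulA : associative loc_mul.
Proof.
elim/rfrac_ind => a s; elim/rfrac_ind => b t; elim/rfrac_ind => c r.
rewrite !rfrac_mul; apply/rfracP; exists denom1; congr (_ * _) => /=; ring.
Qed.

Lemma loc_mulC : commutative loc_mul.
Proof.
elim/rfrac_ind => a s; elim/rfrac_ind => b t.
rewrite !rfrac_mul; apply/rfracP; exists denom1; congr (_ * _) => /=; ring.
Qed.

Lemma loc_mul1 : left_id loc_one loc_mul.
Proof.
elim/rfrac_ind => a s; rewrite !rfrac_mul; apply/rfracP; exists denom1.
by congr (_ * _) => /=; ring.
Qed.

Lemma loc_mulDl : left_distributive loc_mul +%R.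
Proof.
elim/rfrac_ind => a s; elim/rfrac_ind => b t; elim/rfrac_ind => c r.
rewrite rfracD !rfrac_mul rfracD; apply/rfracP; exists denom1.
congr (_ * _) => /=; ring.
Qed.

Lemma loc_one_neq0 : loc_one != 0.
Proof.
apply/eqP => /rfracP[u] /=; rewrite !mulr0 !mulr1 => u0.
by apply: (@mulset0 S); rewrite -u0; exact: asboolW (dvalP u).
Qed.

HB.instance Definition _ := GRing.Zmodule_isComNzRing.Build loc
  loc_mulA loc_mulC loc_mul1 loc_mulDl loc_one_neq0.

Definition to_loc (a : R) : loc := rfrac a denom1.

Section LocModule.
Variable M : lmodType R.

Lemma locmod_scaleA (c d : loc) (u : locmod M) :
  locmod_scale c (locmod_scale d u) = locmod_scale (c * d) u.
Proof.
elim/rfrac_ind: c => a s; elim/rfrac_ind: d => b t; elim/frac_ind: u => x r.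
rewrite -[rfrac a s * _]/(loc_mul _ _) rfrac_mul !frac_scale.
apply/fracP; exists denom1; congr (_ *: _) => /=.
by rewrite !scalerA; congr (_ *: _); ring.
Qed.

Lemma locmod_scale1 : left_id 1 (@locmod_scale M).
Proof.
elim/frac_ind => x s; rewrite -[1]/(rfrac 1 denom1) frac_scale.
by apply/fracP; exists denom1; rewrite /= !scale1r mul1r.
Qed.

Lemma locmod_scaleDr : right_distributive (@locmod_scale M) +%R.
Proof.
elim/rfrac_ind => a s; elim/frac_ind => x t; elim/frac_ind => y r.
rewrite (fracD x t y r) !frac_scale (fracD (a *: x)).
apply/fracP; exists denom1.
congr (_ *: _) => /=.
by rewrite !scalerDr !scalerA; congr (_ *: _ + _ *: _); ring.
Qed.

Lemma locmod_scaleDl (u : locmod M) :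
  {morph (@locmod_scale M)^~ u : c d / c + d}.
Proof.
elim/rfrac_ind => a s; elim/rfrac_ind => b t; elim/frac_ind: u => x r.
rewrite (rfracD a s b t) !frac_scale (fracD (a *: x)).
apply/fracP; exists denom1.
congr (_ *: _) => /=.
by rewrite scalerDl !scalerDr !scalerA; congr (_ *: _ + _ *: _); ring.
Qed.

HB.instance Definition _ := GRing.Zmodule_isLmodule.Build loc (locmod M)
  locmod_scaleA locmod_scale1 locmod_scaleDr locmod_scaleDl.

End LocModule.

End Localization.

Section AtPrime.
Variables (R : comNzRingType) (p : primeSpec R).

Definition prime_compl_set : set R := ~` carrier (prime_val p).

Lemma prime_compl1 : prime_compl_set 1.
Proof. by case: (prime_valP p). Qed.

Lemma prime_complM s t :
  prime_compl_set s -> prime_compl_set t -> prime_compl_set (s * t).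
Proof. by case: (prime_valP p) => _ pp ns nt /pp[]. Qed.

Lemma prime_compl0 : ~ prime_compl_set 0.
Proof. by apply; case: (prime_val p). Qed.

Definition prime_compl : mulset R :=
  MulSet prime_compl1 prime_complM prime_compl0.

Definition loc_at : comNzRingType := loc prime_compl.
Definition locmod_at (M : lmodType R) : lmodType loc_at := locmod prime_compl M.

Definition in_supp (M : lmodType R) : Prop := exists u : locmod_at M, u != 0.

End AtPrime.

Section Conductor.
Variable R : comNzRingType.

Definition nonzerodiv_set : set R := [set s | forall a : R, s * a = 0 -> a = 0].

Lemma nonzerodiv1 : nonzerodiv_set 1.
Proof. by move=> a; rewrite mul1r. Qed.

Lemma nonzerodivM s t :
  nonzerodiv_set s -> nonzerodiv_set t -> nonzerodiv_set (s * t).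
Proof. by move=> ns nt a; rewrite -mulrA => /ns /nt. Qed.

Lemma nonzerodiv0 : ~ nonzerodiv_set 0.
Proof. by move=> /(_ 1); rewrite mul0r => /(_ erefl)/eqP; rewrite oner_eq0. Qed.

Definition nonzerodiv : mulset R :=
  MulSet nonzerodiv1 nonzerodivM nonzerodiv0.

Definition total_frac : comNzRingType := loc nonzerodiv.

Definition to_total_frac : R -> total_frac := @to_loc R nonzerodiv.

Definition integral_closure : set total_frac :=
  [set x | integralOver to_total_frac x].

(** A subset of [Q(R)], contained in the image of [R] since [1] is integral. *)
Definition conductor : set total_frac :=
  [set x | forall y, integral_closure y -> range to_total_frac (x * y)].

End Conductor.

Arguments nonzerodiv_set R : clear implicits.
Arguments integral_closure R : clear implicits.
Arguments conductor R : clear implicits.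

Section Depth.
Variables (A : comNzRingType) (M : lmodType A).

(** The submodule [(s_0, ..., s_(n-1)) M]. *)
Definition seq_submodule (s : seq A) : submodule M :=
  span [set x | exists a y, a \in s /\ x = a *: y].

Definition regular_seq (s : seq A) : Prop :=
  (forall i, (i < size s)%N -> forall x : M,
     carrier (seq_submodule (take i s)) (s`_i *: x) ->
     carrier (seq_submodule (take i s)) x) /\
  carrier (seq_submodule s) <> setT.

Definition regular_seq_in (m : ideal A) (s : seq A) : Prop :=
  {in s, forall a, carrier m a} /\ regular_seq s.

(** For the maximal ideal [m] of a local ring, the depth of [M] is the maximal
    length of an [M]-regular sequence in [m]. *)
Definition depth (m : ideal A) (d : nat) : Prop :=
  (exists2 s, regular_seq_in m s & size s = d) /\
  (forall s, regular_seq_in m s -> (size s <= d)%N).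

End Depth.

Section CM.
Variable R : comNzRingType.

(** Here [m] is the maximal ideal of [R_p]. *)
Definition maximal_CM (M : lmodType R) : Prop :=
  finitely_generated M /\
  forall p : primeSpec R, in_supp p M ->
    exists d, krull_dim (loc_at p) d /\
  forall m, is_local m -> depth (locmod_at p M) m d.

Definition CM0 (M : lmodType R) : Prop :=
  maximal_CM M /\
  forall p : primeSpec R, ~ maximal_ideal (prime_val p) ->
    is_free (locmod_at p M).

End CM.

(* Main.v *)
From HB Require Import structures.
From Pilot Require Import Defs.
From mathcomp Require Import all_boot all_algebra.
From mathcomp Require Import boolp classical_sets functions.
From mathcomp Require Import finmap monalg ring.
Import Pilot.Defs.

(** Write [Q] for the total ring of fractions of [R] and [S] for the integral
    closure of [R] in [Q].  Since [R] embeds in its completion, it is reduced; being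
    of dimension one, it has a nonzerodivisor in its maximal ideal, its localizations
    at the other primes are fields, and [CM0 M] means that [M] is finitely generated
    and torsion-free ([torsion_free_CM0], [CM0_torsion_free]).  All three sets of
    annihilators are equal to the set of [r] in [R] that lie in the conductor.

    The conductor annihilates Tor and Ext in positive degrees.  Let [c] be in the
    conductor and [M] in CM_0, generated by [x_1, ..., x_k].  The lattice [S M] in
    the [Q]-module spanned by [M] is projective over [S], so the surjection
    [S^k -> S M] splits; composing the splitting with [c : S^k -> R^k] and
    [R^k -> M] shows that multiplication by [c] on [M] factors through the free
    module [R^k] ([conductor_factor]).  Such a factorization passes to all syzygies
    and gives a homotopy between [c] and [0] on the resolution in positive degrees
    ([resolution_homotopy]).

    Projectivity is proved in matrix form ([integral_projector]): each submodule of
    [Q^n] is the image of a projector with entries in [S].  This comes down to the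
    invertibility of the fractional ideals [(1, y)] of [S].  The Krull--Akizuki
    argument gives a polynomial relation for [y] over [R] in which some coefficient
    is a unit ([unit_relation]), and the partial sums of Horner's scheme for this
    relation provide the inverse of [(1, y)].

    Conversely, let [y] be integral over [R], and let [X] be the ideal of all [a] in
    [R] with [a y^j] in [R] for every [j]; it suffices to place an annihilator [r] in
    [X].  The ideal [X] contains a nonzerodivisor, it embeds in [R^(n+1)] by
    [a |-> (a, a y, ..., a y^n)] with torsion-free cokernel [M], and every linear
    functional [X -> R] takes its values in [X], because it commutes with
    multiplication by [y].  Let [x_1, ..., x_q] generate [X].
    - For Ext, let [N] be the kernel of [R^q -> X].  The extension
      [0 -> N -> R^q -> X -> 0] gives a class in [Ext^2 (M, N)].  If [r] kills it
      then multiplication by [r] on [X] factors as [X -> R^q -> X], so that [r] is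
      the sum of the [f_i (x_i)] for functionals [f_i], an element of [X].
    - For Tor, let [N] be the quotient of [R^q] by the vectors proportional to
      [(x_i)_i].  The element [sum_i x_i (x) e_i] of [X (x) N] vanishes in
      [R^(n+1) (x) N], hence is a class of [Tor_1 (M, N)].  Mapping [x (x) u] to the
      class of [x u] in [R^q / X (x_i)_i] shows that if [r] kills it then
      [r (x_i)_i = a (x_i)_i] with [a] in [X], so that [r = a]. *)

Set Implicit Arguments.
Unset Strict Implicit.
Unset Printing Implicit Defensive.

Import GRing.Theory.

Local Open Scope ring_scope.
Local Open Scope classical_set_scope.

#[global] Arguments carrier {R M} s x : simpl never.

(** * Spans, ideals and Noetherian induction *)

Section Span.
Variables (R : comNzRingType) (M : lmodType R).

Lemma span_gen (A : set M) x : A x -> carrier (span A) x.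
Proof. by move=> Ax S; apply. Qed.

Lemma carrier_sum (S : submodule M) (I : Type) (r : seq I) (P : pred I)
    (F : I -> M) :
  (forall i, P i -> carrier S (F i)) -> carrier S (\sum_(i <- r | P i) F i).
Proof. by move=> SF; apply: big_ind => //; [exact: carrier0|exact: carrierD]. Qed.

Lemma carrierN (S : submodule M) x : carrier S x -> carrier S (- x).
Proof. by move=> Sx; rewrite -scaleN1r; exact: carrierZ. Qed.

Lemma span_seqP (s : seq M) x : carrier (span [set` s]) x <->
  exists c : nat -> R, x = \sum_(i < size s) c i *: s`_i.
Proof.
split; last first.
  by move=> [c ->]; apply: carrier_sum => i _; apply/carrierZ/span_gen/mem_nth.
have T0 : exists c : nat -> R, 0 = \sum_(i < size s) c i *: s`_i.
  by exists (fun=> 0); rewrite big1 // => i _; rewrite scale0r.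
have TP a (y z : M) : (exists c : nat -> R, y = \sum_(i < size s) c i *: s`_i) ->
    (exists c : nat -> R, z = \sum_(i < size s) c i *: s`_i) ->
    exists c : nat -> R, a *: y + z = \sum_(i < size s) c i *: s`_i.
  move=> [c ->] [d ->]; exists (fun i => a * c i + d i).
  rewrite scaler_sumr -big_split; apply: eq_bigr => i _ /=.
  by rewrite scalerDl scalerA.
move/(_ (Submodule T0 TP)); apply=> y /= ys.
exists (fun i => (i == index y s)%:R); have lt_s : (index y s < size s)%N.
  by rewrite index_mem.
rewrite (bigD1 (Ordinal lt_s)) //= eqxx scale1r nth_index // big1 ?addr0 //.
by move=> i ni; case: eqP => [ei|_]; rewrite ?scale0r //; case/eqP: ni; exact/val_inj.
Qed.

Lemma span_sub (A : set M) (S : submodule M) :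
  A `<=` carrier S -> carrier (span A) `<=` carrier S.
Proof. by move=> AS x; exact. Qed.

End Span.

Section Noetherian.
Variable R : comNzRingType.
Implicit Types (I J p : ideal R) (x y a b : R).

Definition mk_ideal (A : set R) (A0 : A 0)
    (AP : forall a x y, A x -> A y -> A (a * x + y)) : ideal R :=
  @Submodule R R^o A A0 AP.

Lemma idealD I x y : carrier I x -> carrier I y -> carrier I (x + y).
Proof. exact: carrierD. Qed.

Lemma idealB I x y : carrier I x -> carrier I y -> carrier I (x - y).
Proof. exact: carrierB. Qed.

Lemma idealMl I a x : carrier I x -> carrier I (a * x).
Proof. exact: (@carrierZ R R^o). Qed.

Lemma idealMr I a x : carrier I x -> carrier I (x * a).
Proof. by rewrite mulrC; exact: idealMl. Qed.

Lemma ideal1 I x : carrier I 1 -> carrier I x.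
Proof. by rewrite -[x]mulr1; exact: idealMl. Qed.

Lemma ideal_adj0 I a : exists c x, carrier I x /\ 0 = c * a + x.
Proof. by exists 0, 0; split; [exact: carrier0 | rewrite mul0r addr0]. Qed.

Lemma ideal_adjP I a b x y :
  (exists c z, carrier I z /\ x = c * a + z) ->
  (exists c z, carrier I z /\ y = c * a + z) ->
  exists c z, carrier I z /\ b * x + y = c * a + z.
Proof.
move=> [c [z [Iz ->]]] [d [t [It ->]]]; exists (b * c + d), (b * z + t).
by split; [apply: idealD => //; exact: idealMl | ring].
Qed.

Definition ideal_adj I a : ideal R :=
  mk_ideal (ideal_adj0 I a) (@ideal_adjP I a).

Lemma sub_ideal_adj I a : carrier I `<=` carrier (ideal_adj I a).
Proof. by move=> x Ix; exists 0, x; rewrite mul0r add0r. Qed.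

Lemma mem_ideal_adj I a : carrier (ideal_adj I a) a.
Proof. by exists 1, 0; split; [exact: carrier0 | rewrite mul1r addr0]. Qed.

Lemma zero_idealP a x y : [set 0] x -> [set 0] y -> [set 0] (a * x + y).
Proof. by move=> /= -> ->; rewrite mulr0 addr0. Qed.

Definition zero_ideal : ideal R := mk_ideal erefl zero_idealP.

Hypothesis noeth : is_noetherian R.

Lemma chain_stationary (f : nat -> ideal R) :
  (forall n, carrier (f n) `<=` carrier (f n.+1)) ->
  exists n, forall k, carrier (f k) `<=` carrier (f n).
Proof.
move=> fS.
have fle m n : (m <= n)%N -> carrier (f m) `<=` carrier (f n).
  elim: n => [|n IHn]; first by rewrite leqn0 => /eqP ->.
  rewrite leq_eqVlt => /predU1P[-> //|/IHn le x /le]; exact: fS.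
have U0 : exists n, carrier (f n) 0 by exists 0%N; exact: carrier0.
have UP a x y : (exists n, carrier (f n) x) -> (exists n, carrier (f n) y) ->
    exists n, carrier (f n) (a * x + y).
  move=> [m fx] [n fy]; exists (maxn m n); apply: idealD.
    by apply/idealMl/(fle m) => //; rewrite leq_maxl.
  by apply/(fle n) => //; rewrite leq_maxr.
have [s Us] := noeth (mk_ideal U0 UP).
have [n fn] : exists n, {in s, forall x, carrier (f n) x}.
  have: {in s, forall x, exists n, carrier (f n) x}.
    move=> x xs; have: carrier (mk_ideal U0 UP) x by rewrite Us; exact: span_gen.
    exact.
  elim: s {Us} => [|x s IHs] sU; first by exists 0%N.
  have [n fn] := IHs (fun y ys => sU y (mem_behead (s := x :: s) ys)).
  have [m fm] := sU x (mem_head _ _).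
  exists (maxn m n) => y; rewrite inE => /predU1P[->|/fn].
    by apply: (fle m) fm; rewrite leq_maxl.
  by apply: fle; rewrite leq_maxr.
exists n => k x fx; suff: carrier (ideal_gen [set` s]) x by apply=> y /fn.
by rewrite -Us; exists k.
Qed.

Lemma noeth_max (P : ideal R -> Prop) : (exists I, P I) ->
  exists I, P I /\ forall J, P J -> carrier I `<=` carrier J ->
    carrier J `<=` carrier I.
Proof.
move=> [I0 PI0]; apply: contrapT => nmax.
have step (u : {I | P I}) : {v : {I | P I} |
    carrier (sval u) `<=` carrier (sval v) /\
    ~ carrier (sval v) `<=` carrier (sval u)}.
  apply: cid; apply: contrapT => nv; apply: nmax; exists (sval u).
  split; first exact: (svalP u).
  by move=> J PJ uJ; apply: contrapT => nJ; apply: nv; exists (exist _ J PJ).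
have [f [_ fS]] := dependent_choice step (exist P I0 PI0).
have [n fn] := @chain_stationary (fun n => sval (f n)) (fun n => (fS n).1).
by have [_ /(_ (fn n.+1))] := fS n.
Qed.

(** An ideal maximal among those that contain [I] and avoid [T] is prime: if it
    contains neither [x] nor [y] then adjoining either of them meets [T], and the
    product of the two elements of [T] lies in the ideal as soon as [x y] does. *)
Lemma prime_avoiding (T : set R) I : T 1 ->
  (forall x y, T x -> T y -> T (x * y)) ->
  (forall x, carrier I x -> ~ T x) ->
  exists p, [/\ prime_ideal p, carrier I `<=` carrier p &
    forall x, carrier p x -> ~ T x].
Proof.
move=> T1 TM IT.
have [|p [[Ip pT] pmax]] := @noeth_max
    (fun J => carrier I `<=` carrier J /\ forall x, carrier J x -> ~ T x).
  by exists I; split=> // x.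
exists p; split=> //; split=> [p1|x y pxy]; first exact: (pT 1).
have [px|npx] := pselect (carrier p x); first by left.
have [py|npy] := pselect (carrier p y); first by right.
have meet z : ~ carrier p z -> exists2 t, T t & carrier (ideal_adj p z) t.
  move=> npz; apply: contrapT => nt; apply: npz.
  apply: (pmax (ideal_adj p z)); last exact: mem_ideal_adj.
    split=> [t It|t pt Tt]; first by apply/sub_ideal_adj/Ip.
    by apply: nt; exists t.
  exact: sub_ideal_adj.
have [t Tt [c [u [pu et]]]] := meet _ npx.
have [t1 Tt1 [d [v [pv et1]]]] := meet _ npy.
have /pT[] : carrier p (t * t1); last exact: TM.
rewrite et et1.
rewrite mulrDl; apply: idealD; last exact: idealMr.
rewrite mulrDr; apply: idealD; last exact: idealMl.
by rewrite mulrACA; exact: idealMl.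
Qed.

End Noetherian.

Definition linear_of (R : comNzRingType) (M N : lmodType R) (f : M -> N)
    (lf : linear f) : {linear M -> N} :=
  HB.pack f (GRing.isLinear.Build R M N *:%R f lf).

Lemma linear_ofE (R : comNzRingType) (M N : lmodType R) (f : M -> N)
  (lf : linear f) x : linear_of lf x = f x.
Proof. by []. Qed.

(** * Noetherian local rings, reduced rings of dimension one *)

Section Local.
Variables (R : comNzRingType) (m : ideal R).
Hypotheses (noeth : is_noetherian R) (loc_m : is_local m).
Implicit Types (I J K L p q : ideal R) (x y a b s : R).

Lemma max_ideal_prime p : maximal_ideal p -> prime_ideal p.
Proof.
move=> [p1 pmax]; split=> // x y pxy.
have [px|npx] := pselect (carrier p x); [by left | right].
have [a1|na1] := pselect (carrier (ideal_adj p x) 1); last first.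
  case: npx; apply: (pmax _ (@sub_ideal_adj _ _ _) na1); exact: mem_ideal_adj.
have [c [z [pz e1]]] := a1.
rewrite -[y]mul1r e1 mulrDl -mulrA; apply: idealD; last exact: idealMr.
exact: idealMl.
Qed.

Lemma local_prime : prime_ideal m.
Proof. by apply: max_ideal_prime; case: loc_m. Qed.

Lemma proper_sub_max I : ~ carrier I 1 -> carrier I `<=` carrier m.
Proof.
move=> I1; have [|J [[IJ J1] Jmax]] := noeth_max noeth
    (P := fun J => carrier I `<=` carrier J /\ ~ carrier J 1).
  by exists I; split=> // x.
have <- // : carrier J = carrier m.
apply: loc_m.2; split=> // K JK K1; apply: Jmax => //; split=> // x Ix.
exact/JK/IJ.
Qed.

Lemma local_unit x : ~ carrier m x -> exists u, u * x = 1.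
Proof.
move=> mx; have [u1|nu1] := pselect (carrier (ideal_adj (zero_ideal R) x) 1).
  by case: u1 => u [z [-> ->]]; exists u; rewrite addr0.
by case: mx; apply: (proper_sub_max nu1); exact: mem_ideal_adj.
Qed.

Lemma local_unit1B a : carrier m a -> exists u, u * (1 - a) = 1.
Proof.
move=> ma; apply: local_unit => m1a; have [m1 _] := local_prime; apply: m1.
by rewrite -[1](subrK a); exact: idealD.
Qed.

Lemma nonmax_prime_sub p : prime_ideal p -> ~ maximal_ideal p ->
  carrier p `<` carrier m.
Proof.
move=> [p1 _] npmax; split; first exact: proper_sub_max.
move=> mp; apply: npmax; split=> // I pI I1 x Ix.
by apply/mp/(proper_sub_max I1).
Qed.

(** The generators are eliminated one at a time: writing [v = a z] and expanding
    [z] shows that [(1 - a c) v], hence [v], lies in the span of the others. *)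
Lemma Nakayama_principal (M : lmodType R) a : finitely_generated M ->
  carrier m a -> (forall x : M, exists y : M, x = a *: y) -> forall x : M, x = 0.
Proof.
move=> [s sM] ma aM; have {}sM (x : M) : carrier (span [set` s]) x by rewrite sM.
elim: s sM => [|v s IHs] sM x.
  by have /span_seqP[c ->] := sM x; rewrite big_ord0.
apply: IHs => {}x; have: carrier (span [set` v :: s]) x by exact: sM.
move: x.
apply: (@span_sub R M) => z /=; rewrite inE => /predU1P[{z}->|zs]; last exact: span_gen.
have [z vaz] := aM v; have /span_seqP[c /=] := sM z.
rewrite big_ord_recl /= => ez.
have [|u u1] := @local_unit1B (a * c 0%N); first exact: idealMr.
have -> : v = u *: ((1 - a * c 0%N) *: v) by rewrite scalerA u1 scale1r.
apply: carrierZ.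
rewrite scalerBl scale1r {1}vaz ez scalerDr scalerA [_ + _ *: \sum_(_ < _) _]addrC addrK.
by apply/carrierZ/carrier_sum => i _; rewrite add0n; apply/carrierZ/span_gen/mem_nth.
Qed.

Lemma sub_ideal_exp I k : (forall f : 'I_k -> R, (forall i, carrier m (f i)) ->
    carrier I (\prod_i f i)) ->
  carrier (ideal_exp m k) `<=` carrier I.
Proof. by move=> mI; apply: (@span_sub R R^o) => x [f mf ->]; exact: mI. Qed.

(** An ideal maximal among those that contain [K] but no power of [m] would be
    prime, hence contain [m], all of whose elements are nilpotent modulo [K]. *)
Lemma exp_sub_of_nilpotent K :
  (forall a, carrier m a -> exists n, carrier K (a ^+ n)) ->
  exists k, carrier (ideal_exp m k) `<=` carrier K.
Proof.
move=> mK; pose good I k := forall f : 'I_k -> R,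
  (forall i, carrier m (f i)) -> carrier I (\prod_i f i).
suff [k gk] : exists k, good K k by exists k; exact: sub_ideal_exp.
apply: contrapT => nK.
have [|L [[KL nL] Lmax]] := noeth_max noeth
    (P := fun J => carrier K `<=` carrier J /\ ~ exists k, good J k).
  by exists K; split=> // x.
have adj x : ~ carrier L x -> exists k, good (ideal_adj L x) k.
  move=> Lx; apply: contrapT => nk; apply: Lx.
  apply: (Lmax (ideal_adj L x)); last exact: mem_ideal_adj.
    by split=> // y Ky; apply/sub_ideal_adj/KL.
  exact: sub_ideal_adj.
have L1 : ~ carrier L 1.
  by move=> L1; apply: nL; exists 0%N => f _; rewrite big_ord0.
have Lprime x y : carrier L (x * y) -> carrier L x \/ carrier L y.
  move=> Lxy; have [Lx|nLx] := pselect (carrier L x); first by left.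
  have [Ly|nLy] := pselect (carrier L y); first by right.
  case: nL; have [k gk] := adj _ nLx; have [l gl] := adj _ nLy.
  exists (k + l)%N => f mf; rewrite big_split_ord /=.
  have [c [z [Lz ->]]] := gk (fun i => f (lshift l i)) (fun i => mf _).
  have [d [t [Lt ->]]] := gl (fun i => f (rshift k i)) (fun i => mf _).
  rewrite mulrDl; apply: idealD; last exact: idealMr.
  rewrite mulrDr; apply: idealD; last exact: idealMl.
  by rewrite mulrACA; exact: idealMl.
apply: nL; exists 1%N => f mf; rewrite big_ord1.
have [n Kn] := mK _ (mf ord0); have {Kn} : carrier L (f ord0 ^+ n) by exact: KL.
by elim: n => [|n IHn]; rewrite ?expr0 // exprS => /Lprime[].
Qed.

(** Let [K] be maximal among the ideals that contain [m x] but not [x].  For [a] in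
    [m] the ideals [(K : a^n)] stabilise at some [j], and [a^j] lies in [K]: else
    [x = c a^j + z] with [z] in [K], then [c a^(j+1)] is in [K] because [a x] is,
    so [c a^j] and [x] are too.  Hence a power of [m] lies in [K], and [x] with it. *)
Lemma Krull_intersection x :
  (forall k, carrier (ideal_exp m k) x) -> x = 0.
Proof.
move=> mx; apply: contrapT => x0.
have mx0 : exists a, carrier m a /\ 0 = a * x :> R.
  by exists 0; rewrite mul0r; split=> //; exact: carrier0.
have mxP a y z : (exists b, carrier m b /\ y = b * x) ->
    (exists b, carrier m b /\ z = b * x) ->
    exists b, carrier m b /\ a * y + z = b * x.
  move=> [b [mb ->]] [c [mc ->]]; exists (a * b + c); split; last by ring.
  by apply: idealD => //; exact: idealMl.
have [|K [[mxK Kx] Kmax]] := noeth_max noeth (P := fun J =>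
    (forall a, carrier m a -> carrier J (a * x)) /\ ~ carrier J x).
  exists (mk_ideal mx0 mxP); split; first by move=> a ma; exists a.
  move=> [a [ma xax]]; have [u u1] := local_unit1B ma.
  apply: x0; rewrite -[x]mul1r -u1 -mulrA mulrBl mul1r.
  by rewrite -xax subrr mulr0.
apply: (Kx); have [k mkK] : exists k, carrier (ideal_exp m k) `<=` carrier K;
  last exact/mkK/mx.
apply: exp_sub_of_nilpotent => a ma.
have col0 n : carrier K (0 * a ^+ n) by rewrite mul0r; exact: carrier0.
have colP n b y z : carrier K (y * a ^+ n) -> carrier K (z * a ^+ n) ->
    carrier K ((b * y + z) * a ^+ n).
  by move=> Ky Kz; rewrite mulrDl -mulrA; apply: idealD => //; exact: idealMl.
have [|j colj] := chain_stationary noeth (f := fun n =>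
    @mk_ideal R [set y | carrier K (y * a ^+ n)] (col0 n) (colP n)).
  move=> n y Ky; change (carrier K (y * a ^+ n.+1)).
  by rewrite exprSr mulrA; exact: idealMr.
exists j; apply: contrapT => Kj.
have [c [z [Kz ex]]] : carrier (ideal_adj K (a ^+ j)) x.
  apply: contrapT => nx; apply: Kj; apply: (Kmax (ideal_adj K (a ^+ j))).
  - split=> // b mb; apply: sub_ideal_adj; exact: mxK.
  - exact: sub_ideal_adj.
  - exact: mem_ideal_adj.
have Kc : carrier K (c * a ^+ j).
  apply: (colj j.+1); change (carrier K (c * a ^+ j.+1)); rewrite exprS mulrCA.
  rewrite -[_ * _](addrK (a * z)) -mulrDr -ex.
  by apply: idealB; [exact: mxK | exact: idealMl].
by apply: Kx; rewrite ex; exact: idealD.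
Qed.


(** By Krull's theorem [R] embeds in its completion, as constant sequences. *)
Lemma completion_reduced_sub : is_reduced (completion m) -> is_reduced R.
Proof.
move=> redc x n xn0.
have cx y : cauchy_pred m (fun=> y).
  apply/asboolP => k; exists 0%N => i j _ _ /=; rewrite subrr; exact: carrier0.
pose cst y : cauchy_seq m := Sub (fun=> y) (cx y).
have cstX k : completion_pi (cst x) ^+ k = completion_pi (cst (x ^+ k)).
  elim: k => [|k IHk].
    rewrite !expr0; apply: (congr1 (@completion_pi R m)); exact: val_inj.
  rewrite !exprS IHk -[LHS]/(completion_mul _ _) completion_piM.
  by apply: (congr1 (@completion_pi R m)); exact: val_inj.
have /redc : completion_pi (cst x) ^+ n = 0.
  have -> : (0 : completion m) = completion_pi 0 by rewrite /completion_pi raddf0.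
  by rewrite cstX xn0; apply: (congr1 (@completion_pi R m)); exact: val_inj.
have -> : (0 : completion m) = completion_pi 0 by rewrite /completion_pi raddf0.
move=> /completion_piP/asboolP nx.
apply: Krull_intersection => k; have [l /(_ l (leqnn l))] := nx k.
by rewrite subr0.
Qed.

Hypothesis red : is_reduced R.

(** Choose [x] in [I] with maximal second annihilator: if [x w = 0] with [w] in
    [I] nonzero then [ann (x + w)] is the intersection of [ann x] and [ann w],
    which does not contain [w]. *)
Lemma faithful_ideal_nonzerodiv I :
  (forall z, (forall x, carrier I x -> z * x = 0) -> z = 0) ->
  exists2 x : R, carrier I x & nonzerodiv_set R x.
Proof.
move=> faithI.
have aa0 x u : u * x = 0 -> 0 * u = 0 by rewrite mul0r.
have aaP x b y z : (forall u, u * x = 0 -> y * u = 0) ->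
    (forall u, u * x = 0 -> z * u = 0) ->
    forall u, u * x = 0 -> (b * y + z) * u = 0.
  by move=> xy xz u ux; rewrite mulrDl -mulrA xy // xz // mulr0 addr0.
pose aa x := mk_ideal (aa0 x) (aaP x).
have [|J [[x Ix Jx] Jmax]] := noeth_max noeth
    (P := fun J => exists2 x, carrier I x & carrier J = carrier (aa x)).
  by exists (aa 0), 0 => //; exact: carrier0.
exists x => // z xz0; apply: contrapT => z0.
have [y Iy zy0] : exists2 y, carrier I y & z * y <> 0.
  apply: contrapT => ny; apply/z0/faithI => y Iy.
  by apply: contrapT => zy; apply: ny; exists y.
pose w := z * y; have Iw : carrier I w by exact: idealMl.
have xw0 : x * w = 0 by rewrite /w mulrA xz0 mul0r.
have annD u : u * (x + w) = 0 -> u * x = 0 /\ u * w = 0.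
  move=> uxw; have ux0 : u * x = 0.
    apply: (red (n := 2)); rewrite expr2.
    have -> : u * x * (u * x) = (u * (x + w)) * (u * x) - u * u * (x * w) by ring.
    by rewrite uxw xw0 mul0r mulr0 subr0.
  by split=> //; move: uxw; rewrite mulrDr ux0 add0r.
suff: carrier J w.
  rewrite Jx => /(_ w); rewrite mulrC xw0 => /(_ erefl) ww.
  by apply: zy0; apply: (red (n := 2)); rewrite expr2.
apply: (Jmax (aa (x + w))).
- by exists (x + w) => //; exact: idealD.
- by rewrite Jx => u xu v /annD[vx _]; exact: xu.
- by move=> u /annD[_]; rewrite mulrC.
Qed.

Hypothesis dim1 : krull_dim R 1.

Lemma nonzerodiv_in_max : exists2 x : R, carrier m x & nonzerodiv_set R x.
Proof.
apply: faithful_ideal_nonzerodiv => z mz.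
have [mz'|nmz] := pselect (carrier m z).
  by apply: (red (n := 2)); rewrite expr2; exact: mz.
have [u u1] := local_unit nmz.
have m0 x : carrier m x -> x = 0.
  by move=> mx; rewrite -[x]mul1r -u1 -mulrA mz // mulr0.
have [[c [cP /(_ 0%N isT)[_ c01]]] _] := dim1.
case: c01 => x c1x; have [c11 _] := cP 1%N isT.
by rewrite (m0 x (proper_sub_max c11 c1x)); exact: carrier0.
Qed.

(** In other words [R_p] is a field.  If no product [a^n s] with [s] outside [p] were
    zero, a prime avoiding these products would lie strictly below [p] and give a
    chain of length two; and [a^n s = 0] implies [s a = 0] as [R] is reduced. *)
Lemma nonmax_prime_kills p a : prime_ideal p -> ~ maximal_ideal p ->
  carrier p a -> exists2 s, ~ carrier p s & s * a = 0.
Proof.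
move=> [p1 pM] npmax pa; apply: contrapT => nk.
pose T := [set x : R | exists n s, ~ carrier p s /\ x = a ^+ n * s].
have [|||q [[q1 qM] _ qT]] := @prime_avoiding _ noeth T (zero_ideal R).
- by exists 0%N, 1; rewrite mulr1.
- move=> _ _ [n [s [ps ->]]] [k [t [pt ->]]]; exists (n + k)%N, (s * t).
  by split; [move/pM => [] | rewrite exprD; ring].
- move=> _ -> [n [s [ps e0]]]; apply: nk; exists s => //; apply: (red (n := n.+1)).
  have -> : (s * a) ^+ n.+1 = s ^+ n * a * (a ^+ n * s).
    by rewrite exprMn exprSr exprS; ring.
  by rewrite -e0 mulr0.
have qp x : carrier q x -> carrier p x.
  move=> qx; apply: contrapT => px; apply: (qT _ qx).
  by exists 0%N, x; rewrite expr0 mul1r.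
pose c n := if n is n'.+1 then if n' is 0 then p else m else q.
suff /dim1.2 : prime_chain 2 c by [].
split; first by move=> [|[|[|]]] // _; exact: local_prime.
move=> [|[|]] // _; last exact: nonmax_prime_sub.
split=> // pq; apply: (qT a); first exact: pq.
by exists 1%N, 1; rewrite mulr1.
Qed.

Lemma prime_nonzerodiv p s : prime_ideal p -> carrier p s ->
  nonzerodiv_set R s -> carrier p = carrier m.
Proof.
move=> pp ps sreg; apply: loc_m.2; apply: contrapT => npmax.
have [t pt ts0] := nonmax_prime_kills pp npmax ps.
have t0 : t = 0 by apply: sreg; rewrite mulrC.
by apply: pt; rewrite t0; exact: carrier0.
Qed.

(** The only prime that contains [s] is [m], so no prime contains [s] and avoids
    the powers of [a]. *)
Lemma power_in_principal s a : nonzerodiv_set R s -> carrier m a ->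
  exists n c, a ^+ n = c * s.
Proof.
move=> sreg ma; apply: contrapT => npow.
have [|||q [qprime Iq qT]] := @prime_avoiding _ noeth
    [set x | exists n, x = a ^+ n] (ideal_adj (zero_ideal R) s).
- by exists 0%N.
- by move=> _ _ [n ->] [k ->]; exists (n + k)%N; rewrite exprD.
- move=> _ [c [z [-> ->]]] [n e]; apply: npow; exists n, c.
  by rewrite -e addr0.
apply: (qT a); last by exists 1%N.
by rewrite (prime_nonzerodiv qprime _ sreg) //; apply: Iq; exact: mem_ideal_adj.
Qed.

End Local.

(** * The total ring of fractions *)

Section LocMorphism.
Variables (R : comNzRingType) (S : mulset R).

Lemma to_loc_zmod_morphism : zmod_morphism (@to_loc R S).
Proof.
move=> x y; rewrite -[LHS]/(rfrac _ _).
rewrite -[- to_loc S y]/(locmod_opp (frac (M := R^o) y (denom1 S))) frac_opp.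
rewrite -[RHS]/(rfrac x (denom1 S) + rfrac (- y) (denom1 S)) rfracD.
by apply/rfracP; exists (denom1 S) => /=; ring.
Qed.

Lemma to_loc_monoid_morphism : monoid_morphism (@to_loc R S).
Proof.
split=> // x y; rewrite -[RHS]/(loc_mul (rfrac x _) (rfrac y _)) rfrac_mul.
by apply/rfracP; exists (denom1 S) => /=; ring.
Qed.

HB.instance Definition _ :=
  GRing.isZmodMorphism.Build R (loc S) (@to_loc R S) to_loc_zmod_morphism.
HB.instance Definition _ :=
  GRing.isMonoidMorphism.Build R (loc S) (@to_loc R S) to_loc_monoid_morphism.

Lemma loc_frac (y : loc S) : exists a s, mulset_carrier S s /\ to_loc S s * y = to_loc S a.
Proof.
elim/rfrac_ind: y => a s; exists a, (dval s); split.
  exact: asboolW (dvalP s).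
rewrite -[LHS]/(loc_mul (rfrac _ _) (rfrac _ _)) rfrac_mul.
by apply/rfracP; exists (denom1 S) => /=; ring.
Qed.

Lemma loc_unit s : mulset_carrier S s -> exists z, z * to_loc S s = 1.
Proof.
move=> Ss; exists (rfrac 1 (Denom (asboolT Ss))).
rewrite -[LHS]/(loc_mul (rfrac _ _) (rfrac _ _)) rfrac_mul.
by apply/rfracP; exists (denom1 S) => /=; ring.
Qed.

Lemma to_loc_eq0 a : to_loc S a = 0 <-> exists2 u, mulset_carrier S u & u * a = 0.
Proof.
rewrite -[0]/(rfrac 0 (denom1 S)); split.
  move/rfracP => [u /= e]; exists (dval u); first exact: asboolW (dvalP u).
  by move: e; rewrite !mul1r mulr0.
move=> [u Su ua0]; apply/rfracP; exists (Denom (asboolT Su)) => /=.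
by rewrite !mul1r ua0 mulr0.
Qed.

End LocMorphism.

Section TotalFrac.
Variable R : comNzRingType.
Local Notation Q := (total_frac R).
Local Notation toQ := (@to_total_frac R).

HB.instance Definition _ := GRing.RMorphism.copy toQ (to_loc (nonzerodiv R)).

Lemma to_total_frac_inj : injective toQ.
Proof.
move=> a b ab; apply/eqP; rewrite -subr_eq0; apply/eqP.
have /to_loc_eq0[u ureg] : to_loc (nonzerodiv R) (a - b) = 0.
  by rewrite rmorphB; apply/eqP; rewrite subr_eq0; apply/eqP.
exact: ureg.
Qed.

Lemma total_frac_ex (y : Q) :
  exists a s, nonzerodiv_set R s /\ toQ s * y = toQ a.
Proof. exact: (@loc_frac R (nonzerodiv R) y). Qed.

Lemma total_frac_unit s : nonzerodiv_set R s -> exists z, z * toQ s = 1.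
Proof. exact: (@loc_unit R (nonzerodiv R)). Qed.

Lemma total_frac_reg s (y z : Q) : nonzerodiv_set R s ->
  toQ s * y = toQ s * z -> y = z.
Proof.
move=> /total_frac_unit[t t1] e.
by rewrite -[y]mul1r -[z]mul1r -t1 -!mulrA e.
Qed.

End TotalFrac.

(** * Finite colength and the Krull--Akizuki argument *)

Section FiniteLength.
Variables (R : comNzRingType) (m : ideal R).
Hypotheses (noeth : is_noetherian R) (loc_m : is_local m).
Implicit Types (I J : ideal R) (x y a b : R).

(** [J / J0] has a composition series, with factors [R / m]. *)
Inductive finite_colength J0 : ideal R -> Prop :=
| FinLenBase : finite_colength J0 J0
| FinLenStep J g : finite_colength J0 J ->
    (forall x, carrier m x -> carrier J (x * g)) ->
    finite_colength J0 (ideal_adj J g).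

Lemma finite_colength_sub J0 J :
  finite_colength J0 J -> carrier J0 `<=` carrier J.
Proof. by elim=> // {}J g _ IH _ x /IH; exact: sub_ideal_adj. Qed.

(** A step of the composition series adds one element [g] modulo [J], and whether
    [f n] contains an element of [g + J] is eventually constant in [n]; together
    with stationarity on [J] this decides [f n] on the larger ideal. *)
Lemma finite_colength_dcc J0 J (f : nat -> ideal R) : finite_colength J0 J ->
  (forall n, carrier J0 `<=` carrier (f n)) ->
  (forall n k, (n <= k)%N -> carrier (f k) `<=` carrier (f n)) ->
  exists n, forall k x, (n <= k)%N ->
    carrier J x -> carrier (f n) x -> carrier (f k) x.
Proof.
move=> flJ J0f fdec; elim: flJ => [|{}J g _ [n IHn] mg].
  by exists 0%N => k x _ J0x _; exact: J0f.
have [meet|nmeet] :=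
    pselect (forall k, exists2 j, carrier J j & carrier (f k) (g + j)).
  exists n => k _ nk [c [z [Jz ->]]] fx.
  have [j Jj fgj] := meet k.
  rewrite -[_ + z](subrK (c * (g + j))); apply: idealD; last exact: idealMl.
  apply: IHn => //; last first.
    by apply: idealB => //; apply/idealMl/(fdec n k).
  rewrite (_ : _ - _ = z - c * j); last by ring.
  by apply: idealB => //; exact: idealMl.
have [n0 nn0] : exists k, ~ exists2 j, carrier J j & carrier (f k) (g + j).
  by apply: contrapT => nk; apply: nmeet => k; apply: contrapT => ?; apply: nk; exists k.
exists (maxn n n0) => k _ + [c [z [Jz ->]]] fx.
rewrite geq_max => /andP[nk n0k].
have [mc|nmc] := pselect (carrier m c).
  apply: IHn => //; first by apply: idealD => //; exact: mg.
  by apply: fdec fx; rewrite leq_maxl.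
have [u u1] := local_unit noeth loc_m nmc.
case: nn0; exists (u * z); first exact: idealMl.
rewrite (_ : g + _ = u * (c * g + z)).
  by apply/idealMl/(fdec _ _ _ _ fx); rewrite leq_maxr.
by rewrite mulrDr mulrA u1 mul1r.
Qed.

(** If the largest [J] of finite colength over [J0] were proper, a maximal element
    [(J : g)] among the ideals with [g] not in [J] would be prime, hence equal to
    [m], and [J + g R] would again have finite colength. *)
Lemma finite_colength1 J0 :
  (forall p, prime_ideal p -> carrier J0 `<=` carrier p ->
    carrier p = carrier m) ->
  exists2 J, finite_colength J0 J & carrier J 1.
Proof.
move=> J0m; have [|J [flJ Jmax]] := noeth_max noeth (P := finite_colength J0).
  by exists J0; exact: FinLenBase.
exists J => //; apply: contrapT => J1.
have col0 g : carrier J (0 * g) by rewrite mul0r; exact: carrier0.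
have colP g b y z : carrier J (y * g) -> carrier J (z * g) ->
    carrier J ((b * y + z) * g).
  by move=> Jy Jz; rewrite mulrDl -mulrA; apply: idealD => //; exact: idealMl.
pose col g := @mk_ideal R [set y | carrier J (y * g)] (col0 g) (@colP g).
have [|p [[g Jg pg] pmax]] := noeth_max noeth (P := fun p =>
    exists2 g, ~ carrier J g & carrier p = carrier (col g)).
  by exists (col 1), 1.
have pP x : carrier p x <-> carrier J (x * g) by rewrite pg.
have p_prime : prime_ideal p.
  split=> [/pP|x y /pP Jxyg]; first by rewrite mul1r.
  have [Jxg|nJxg] := pselect (carrier J (x * g)); [left | right]; first exact/pP.
  apply: (pmax (col (x * g))); first by exists (x * g).
    move=> u /pP Jug; change (carrier J (u * (x * g))).
    by rewrite mulrCA; exact: idealMl.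
  by change (carrier J (y * (x * g))); rewrite mulrA [y * x]mulrC.
have pm := J0m _ p_prime.
apply/Jg/(Jmax (ideal_adj J g)); last exact: mem_ideal_adj.
  apply: FinLenStep => // x mx; apply/pP; rewrite pm // => z /finite_colength_sub.
  by move=> Jz; apply/pP/idealMr/Jz.
exact: sub_ideal_adj.
Qed.

End FiniteLength.

Section UnitRelation.
Variables (R : comNzRingType) (m : ideal R).
Hypotheses (noeth : is_noetherian R) (loc_m : is_local m) (red : is_reduced R).
Hypothesis dim1 : krull_dim R 1.
Local Notation Q := (total_frac R).
Local Notation toQ := (@to_total_frac R).

Definition adjoined (y z : Q) := exists g : {poly R}, z = (map_poly toQ g).[y].

Lemma adjoined_sum y n (c : 'I_n -> R) (z : 'I_n -> Q) :
  (forall i, adjoined y (z i)) -> adjoined y (\sum_i toQ (c i) * z i).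
Proof.
move=> /choice[g zg]; exists (\sum_i (c i)%:P * g i).
rewrite rmorph_sum horner_sum; apply: eq_bigr => i _.
by rewrite rmorphM /= map_polyC hornerM hornerC zg.
Qed.

Lemma adjoined_axpy y c z t : adjoined y z -> adjoined y t ->
  adjoined y (toQ c * z + t).
Proof.
move=> [g ->] [h ->]; exists (c%:P * g + h).
by rewrite rmorphD rmorphM /= map_polyC !hornerE.
Qed.

Lemma adjoinedX y n : adjoined y (y ^+ n).
Proof. by exists 'X^n; rewrite map_polyXn hornerXn. Qed.

(** The key step in the Krull--Akizuki theorem: [R[y]] is contained in
    [b^-nu R + b R[y]], where [nu] is the index at which the ideals
    [b^n R[y] :&: R + b R] stabilise; they do because [R / b R] has finite
    length. *)
Lemma Krull_Akizuki_step a b (y : Q) : nonzerodiv_set R b -> toQ b * y = toQ a ->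
  exists nu, forall h z, adjoined y z -> range toQ (toQ (b ^+ h) * z) ->
    exists r z', adjoined y z' /\
      toQ (b ^+ nu) * z = toQ r + toQ (b ^+ nu.+1) * z'.
Proof.
move=> breg bya.
have A0 : adjoined y 0 by exists 0; rewrite rmorph0 horner0.
pose A n (r : R) := exists z c,
  adjoined y z /\ toQ r = toQ (b ^+ n) * z + toQ (b * c).
have I0 n : A n 0.
  by exists 0, 0; split=> //; rewrite !mulr0 !rmorph0 addr0.
have IP n d x r : A n x -> A n r -> A n (d * x + r).
  move=> [z [c [Az ex]]] [z' [c' [Az' ez']]].
  exists (toQ d * z + z'), (d * c + c'); split; first exact: adjoined_axpy.
  by rewrite rmorphD rmorphM /= ex ez' !rmorphM rmorphD rmorphM /=; ring.
pose I n := mk_ideal (I0 n) (@IP n).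
have bI n : carrier (I n) b.
  by exists 0, 1; split=> //; rewrite mulr0 add0r mulr1.
have Idec n k : (n <= k)%N -> carrier (I k) `<=` carrier (I n).
  move=> /subnKC <- x [z [c [Az ex]]].
  exists (toQ (b ^+ (k - n)) * z + 0), c; split; first exact: adjoined_axpy.
  by rewrite addr0 mulrA -rmorphM -exprD.
have [J flJ J1] : exists2 J,
    finite_colength m (ideal_adj (zero_ideal R) b) J & carrier J 1.
  apply: finite_colength1 => // p p_prime bp.
  apply: (prime_nonzerodiv noeth loc_m red dim1 p_prime _ breg).
  by apply: bp; exact: mem_ideal_adj.
have [|nu stat] := finite_colength_dcc noeth loc_m flJ _ Idec.
  by move=> n _ [c [z [-> ->]]]; rewrite addr0; exact: idealMl.
exists nu; elim=> [|h IHh] z Az [r0 _ er].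
  exists (b ^+ nu * r0), 0; split=> //.
  by rewrite mulr0 addr0 rmorphM /= er expr0 rmorph1 mul1r.
have [lt_h|le_nu] := ltnP h nu.
  exists (b ^+ (nu - h.+1) * r0), 0; split=> //.
  by rewrite mulr0 addr0 rmorphM /= er mulrA -rmorphM -exprD subnK.
have [z1 [c [Az1 er0]]] : carrier (I h.+2) r0.
  apply: stat; [exact/leqW/leqW | exact: ideal1 | apply: (Idec nu h.+1)].
    exact: leqW.
  by exists z, 0; split=> //; rewrite mulr0 rmorph0 addr0.
have Az2 : adjoined y (toQ (- b) * z1 + z) by exact: adjoined_axpy.
have [|r [z' [Az' e']]] := IHh _ Az2.
  exists c => //; apply: (total_frac_reg breg).
  rewrite -rmorphM /=.
  have -> : toQ (b * c) = toQ r0 - toQ (b ^+ h.+2) * z1.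
    by rewrite er0 addrC addKr.
  by rewrite er !exprS !rmorphM rmorphN /=; ring.
exists r, (toQ 1 * z' + z1); split; first exact: adjoined_axpy.
rewrite rmorph1 mul1r mulrDr addrA -e' exprSr rmorphM rmorphN /=; ring.
Qed.

(** By the previous lemma [y^n = b^-nu r n + b z n] with [z n] in [R[y]].  As soon as
    [r n] is a combination of the earlier [r i], subtracting the same combination
    of powers of [y] leaves an element of [b R[y]]: a relation whose coefficient of
    ['X^n] is [1] modulo [m]. *)
Lemma unit_relation (y : Q) : exists f : {poly R},
  root (map_poly toQ f) y /\ exists i u, u * f`_i = 1.
Proof.
have [a [b [breg bya]]] := total_frac_ex y.
have [mb|nmb] := pselect (carrier m b); last first.
  have [u u1] := local_unit noeth loc_m nmb.
  exists (b *: 'X - a%:P); split.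
    rewrite rootE rmorphB /= map_polyZ map_polyX map_polyC !hornerE bya.
    by rewrite subrr.
  by exists 1%N, u; rewrite coefB coefZ coefX coefC mulr1 subr0.
have [nu KA] := Krull_Akizuki_step breg bya.
have KAn n : exists rz : R * Q, adjoined y rz.2 /\
    toQ (b ^+ nu) * y ^+ n = toQ rz.1 + toQ (b ^+ nu.+1) * rz.2.
  have [|r [z [Az e]]] := KA n _ (adjoinedX y n); last by exists (r, z).
  by exists (a ^+ n) => //; rewrite !rmorphXn /= -exprMn bya.
have [rz rzP] := choice KAn; pose r n := (rz n).1; pose z n := (rz n).2.
pose J n := ideal_gen [set` [seq r i | i <- iota 0 n]].
have [|n Jn] := chain_stationary noeth (f := J).
  move=> n; apply: (@span_sub R R^o) => x /mapP[i].
  rewrite mem_iota => /andP[_ lt_in] ->; apply: span_gen; apply/mapP.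
  by exists i => //; rewrite mem_iota /= add0n ltnS ltnW.
have {Jn} : carrier (J n) (r n).
  apply: (Jn n.+1); apply: span_gen; apply/mapP; exists n => //.
  by rewrite mem_iota ltnSn.
move/(@span_seqP R R^o) => [c]; rewrite size_map size_iota => er.
have {}er : r n = \sum_(i < n) c i * r i.
  rewrite er; apply: eq_bigr => i _.
  by rewrite (nth_map 0%N) ?size_iota // nth_iota.
have [g eg] : adjoined y (z n - \sum_(i < n) toQ (c i) * z i).
  have := adjoined_axpy (-1) (adjoined_sum c (fun i : 'I_n => (rzP i).1)) (rzP n).1.
  by rewrite rmorphN rmorph1 mulN1r addrC.
have ry : (y ^+ n - \sum_(i < n) toQ (c i) * y ^+ i)
    = toQ b * (z n - \sum_(i < n) toQ (c i) * z i).
  have bregX k : nonzerodiv_set R (b ^+ k).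
    by elim: k => [|k]; [exact: nonzerodiv1 | rewrite exprS; exact: nonzerodivM].
  apply: (total_frac_reg (bregX nu)); rewrite mulrA -rmorphM -exprSr /=.
  rewrite !mulrBr (rzP n).2 -/(r n) er rmorph_sum !mulr_sumr /=.
  rewrite [X in _ - X](eq_bigr (fun i : 'I_n =>
    toQ (c i * r i) + toQ (b ^+ nu.+1) * (toQ (c i) * z i))) => [|i _].
    by rewrite big_split /= opprD addrACA subrr add0r.
  by rewrite mulrCA (rzP i).2 mulrDr -rmorphM mulrCA.
exists ('X^n - \sum_(i < n) c i *: 'X^i - b *: g); split.
  rewrite rootE !rmorphB rmorph_sum !hornerE horner_sum /=.
  rewrite map_polyXn hornerXn map_polyZ hornerZ -eg -ry.
  under eq_bigr => i _ do rewrite map_polyZ map_polyXn hornerZ hornerXn.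
  by rewrite subrr.
have mbg : carrier m (b * g`_n) by exact: idealMr.
have [u u1] := local_unit1B noeth loc_m mbg.
exists n, u; rewrite !coefB coefXn eqxx coefZ coef_sum big1 ?subr0 // => i _.
by rewrite coefZ coefXn gtn_eqF ?mulr0 //; exact: ltn_ord.
Qed.
End UnitRelation.

(** * Integral projectors over the total ring of fractions *)

Section IntegralClosure.
Variables (R Q : comNzRingType) (toQ : {rmorphism R -> Q}).
Local Notation integral := (integralOver toQ).

Lemma integral_sum I (r : seq I) (P : pred I) (F : I -> Q) :
  (forall i, P i -> integral (F i)) -> integral (\sum_(i <- r | P i) F i).
Proof.
move=> intF; apply: big_ind => //; first exact: integral0.
exact: integral_add.
Qed.

Lemma integral_idempotent (e : Q) : e * e = e -> integral e.
Proof.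
move=> ee; apply: (@integral_root_monic _ _ _ e ('X * ('X - 1%:P))).
- by rewrite monicMl ?monicX ?monicXsubC.
- by rewrite rootE !hornerE mulrBr mulr1 ee subrr.
apply/integral_poly => i; rewrite coefXM; case: ifP => _.
  exact: integral0.
rewrite coefB coefX coefC; apply: integral_sub; first exact: integral_nat.
by case: ifP => _; [exact: integral1 | exact: integral0].
Qed.

(** Clearing denominators in the classical way: multiply the relation by the
    power of the leading coefficient that makes it monic in [c y]. *)
Lemma integral_lead_mul n (c : nat -> Q) (y : Q) : (forall i, integral (c i)) ->
  \sum_(i < n.+2) c i * y ^+ i = 0 -> integral (c n.+1 * y).
Proof.
move=> intc cy0; pose l := c n.+1.
pose q : {poly Q} := \poly_(i < n.+1) (c i * l ^+ (n - i)).
apply: (@integral_root_monic _ _ _ _ ('X^(n.+1) + q)).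
- rewrite monicE lead_coefDl ?lead_coefXn // size_polyXn ltnS.
  exact: size_poly.
- rewrite rootE !hornerE horner_poly -/l exprMn.
  apply/eqP; have e := congr1 ( *%R (l ^+ n)) cy0.
  rewrite mulr0 big_ord_recr /= addrC mulrDr in e; apply: etrans e.
  congr (_ + _); first by rewrite exprSr -mulrA.
  rewrite mulr_sumr; apply: eq_bigr => i _; rewrite exprMn.
  have -> : l ^+ n = l ^+ (n - i) * l ^+ i.
    by rewrite -exprD subnK // -ltnS; exact: ltn_ord.
  ring.
have intX z k : integral z -> integral (z ^+ k).
  move=> intz; elim: k => [|k IHk]; first by rewrite expr0; exact: integral1.
  by rewrite exprS; exact: integral_mul.
apply/integral_poly => i; rewrite coefD coefXn coef_poly.
apply: integral_add; first exact: integral_nat.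
by case: ifP => _; [apply: integral_mul => //; apply: intX; exact: intc | exact: integral0].
Qed.

(** Horner's scheme: the leading coefficient times [y] is integral, so it may be
    absorbed in the next coefficient, which gives a relation of lower degree that
    still has integral coefficients. *)
Lemma integral_coef_split n (c : nat -> Q) (y : Q) : (forall i, integral (c i)) ->
  \sum_(i < n.+1) c i * y ^+ i = 0 -> forall i, (i <= n)%N ->
  exists p r, [/\ integral p, integral r, integral (p * y), integral (r * y) & c i = p + r * y].
Proof.
have i0 := integral0 toQ.
elim: n c => [|n IHn] c intc cy0 i.
  rewrite leqn0 => /eqP->; exists 0, 0; rewrite !mul0r addr0; split=> //.
  by move: cy0; rewrite big_ord1 expr0 mulr1.
have intl := integral_lead_mul intc cy0.
rewrite leq_eqVlt => /predU1P[->|].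
  by exists (c n.+1), 0; rewrite !mul0r addr0; split.
rewrite ltnS => le_in; pose c' j := if j == n then c n.+1 * y + c n else c j.
have intc' j : integral (c' j).
  by rewrite /c'; case: ifP => // _; exact: integral_add.
have cy0' : \sum_(i < n.+1) c' i * y ^+ i = 0.
  rewrite -[RHS]cy0 !big_ord_recr /= /c' eqxx -addrA; congr (_ + _).
    by apply: eq_bigr => j _; rewrite ltn_eqF.
  by rewrite exprS; ring.
have [p [r [intp intr intpy intry e]]] := IHn c' intc' cy0' i le_in.
move: e; rewrite /c'; case: eqP => [-> e|_ e]; last by exists p, r.
exists p, (r - c n.+1); split=> //.
- exact: integral_sub.
- by rewrite mulrBl; exact: integral_sub.
- by rewrite mulrBl addrA -e; ring.
Qed.

Hypothesis unit_rel : forall y : Q, exists f : {poly R},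
  root (map_poly toQ f) y /\ exists i u, u * f`_i = 1.

(** The relation splits its unit coefficient as [p + r y] up to a unit, so [(p, r)] is
    the inverse of the fractional ideal [(1, y)] of the integral closure. *)
Lemma fractional_ideal_1y_invertible (y : Q) : exists p r,
  [/\ integral p, integral r, integral (p * y), integral (r * y) & p + r * y = 1].
Proof.
have [f [/eqP fy0 [i [u u1]]]] := unit_rel y.
have inti := fun x => integral_id toQ x.
have lt_i : (i < size f)%N.
  rewrite ltnNge; apply/negP => le_i; move: u1.
  by rewrite nth_default // mulr0 => /eqP; rewrite eq_sym oner_eq0.
have fy : \sum_(j < (size f).-1.+1) toQ f`_j * y ^+ j = 0.
  rewrite (ltn_predK lt_i) -[RHS]fy0 (@horner_coef_wide _ (size f)).
    by apply: eq_bigr => j _; rewrite coef_map.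
  exact: size_poly.
have le_i : (i <= (size f).-1)%N by rewrite -ltnS (ltn_predK lt_i).
have [p [r [ip ir ipy iry e]]] := integral_coef_split (fun j => inti f`_j) fy le_i.
exists (toQ u * p), (toQ u * r); rewrite -!mulrA.
split; try exact: integral_mul.
by rewrite -mulrDr -e -rmorphM u1 rmorph1.
Qed.

Hypothesis vN_regular : forall a : Q, exists a', a * a' * a = a.

(** Locally on the integral closure one of [a] and [b] divides the other.  On the
    part where [a] is invertible this is the invertibility of [(1, b / a)], with [t]
    equal to [p] there; where [a] vanishes take [t = 0]. *)
Lemma Prufer_pair (a b : Q) : exists t p r, [/\ integral t, integral p, integral r,
  t * b = p * a & (1 - t) * a = r * b].
Proof.
have [a' aa'] := vN_regular a.
have inte : integral (a * a').
  by apply: integral_idempotent; rewrite mulrA aa'.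
have [p [r [ip ir ipy iry e1]]] := fractional_ideal_1y_invertible (b * a').
exists (a * a' * p), (p * (b * a')), (a * a' * r).
split=> //; try exact: integral_mul; first by ring.
rewrite (_ : (1 - _) * a = a - (a * a' * a) * p); last by ring.
by rewrite aa' -{1}[a]mulr1 -e1 mulrDr addrC addrA addNr add0r; ring.
Qed.

(** By induction on the length: comparing each [v i] with the next entry splits
    [t i] in two, and the parts in favour of the new entry add up to its [t]. *)
Lemma Prufer_family n (v : nat -> Q) : exists (t : nat -> Q) (s : nat -> nat -> Q),
  [/\ forall i, integral (t i), forall i j, integral (s i j), \sum_(i < n.+1) t i = 1 &
      forall i j, (i <= n)%N -> (j <= n)%N -> t i * v j = s i j * v i].
Proof.
elim: n => [|n [t [s [intt ints t1 ts]]]].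
  have int1 := integral1 toQ.
  exists (fun=> 1), (fun _ _ => 1); split=> //; first by rewrite big_ord1.
  by move=> i j; rewrite !leqn0 => /eqP-> /eqP->.
have /choice[abc abcP] i : exists abc : Q * Q * Q,
    [/\ integral abc.1.1, integral abc.1.2, integral abc.2,
    abc.1.1 * v n.+1 = abc.1.2 * v i & (1 - abc.1.1) * v i = abc.2 * v n.+1].
  by have [a [p [r]]] := Prufer_pair (v i) (v n.+1); exists (a, p, r).
pose a i := (abc i).1.1; pose p i := (abc i).1.2; pose r i := (abc i).2.
have inta i : integral (a i) by case: (abcP i).
have intp i : integral (p i) by case: (abcP i).
have intr i : integral (r i) by case: (abcP i).
have ap i : a i * v n.+1 = p i * v i by case: (abcP i).
have ar i : (1 - a i) * v i = r i * v n.+1 by case: (abcP i).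
have int1a i : integral (1 - a i) by apply: integral_sub => //; exact: integral1.
pose tn := \sum_(i < n.+1) t i * (1 - a i).
pose t' i := if (i <= n)%N then t i * a i else tn.
pose s' i j := if (i <= n)%N then if (j <= n)%N then a i * s i j else t i * p i
  else if (j <= n)%N then \sum_(i < n.+1) s i j * r i else tn.
have inttn : integral tn by apply: integral_sum => i _; exact: integral_mul.
exists t', s'; split.
- by move=> i; rewrite /t'; case: ifP => // _; exact: integral_mul.
- move=> i j; rewrite /s'; case: ifP => _; case: ifP => _ //; try exact: integral_mul.
  by apply: integral_sum => k _; exact: integral_mul.
- rewrite big_ord_recr /= /t' ltnn -t1 -big_split /=.
  apply: eq_bigr => i _; rewrite -ltnS ltn_ord; ring.
move=> i j; rewrite /t' /s'.
have [le_in _|lt_ni le_in] := leqP i n; have [le_jn _|lt_nj le_jn] := leqP j n.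
- by rewrite -mulrA mulrCA ts // mulrA.
- have -> : j = n.+1 by apply/eqP; rewrite eqn_leq le_jn.
  by rewrite -!mulrA ap.
- have -> : i = n.+1 by apply/eqP; rewrite eqn_leq le_in.
  rewrite !mulr_suml; apply: eq_bigr => k _.
  by rewrite -[RHS]mulrA -ar mulrAC ts -1?ltnS // -!mulrA [v k * _]mulrC.
- have -> : i = n.+1 by apply/eqP; rewrite eqn_leq le_in.
  by have -> : j = n.+1 by apply/eqP; rewrite eqn_leq le_jn.
Qed.

(** The matrix [s i j] of a partition of unity for [v] already fixes [v]; cutting its
    rows by the idempotents of the [v i] makes them multiples of [v]. *)
Lemma rank_one_projector n (v : 'rV[Q]_n) : exists P : 'M[Q]_n,
  [/\ forall i j, integral (P i j), forall i, exists q, row i P = q *: v & v *m P = v].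
Proof.
case: n v => [|n] v.
  exists 0; split; [by case | by case | by rewrite !thinmx0].
have [t [s [intt ints t1 ts]]] := Prufer_family n (fun i => v 0 (inord i)).
have {}ts (i j : 'I_n.+1) : t i * v 0 j = s i j * v 0 i.
  by have := ts i j (leq_ord i) (leq_ord j); rewrite !inord_val.
have /choice[v' vv'] i := vN_regular (v 0 i).
exists (\matrix_(i, j) (v 0 i * v' i * s i j)); split.
- move=> i j; rewrite mxE; apply: integral_mul => //; apply: integral_idempotent.
  by rewrite mulrA vv'.
- move=> i; exists (v' i * t i); apply/rowP => j; rewrite !mxE -[RHS]mulrA ts; ring.
apply/rowP => j; rewrite mxE -[RHS]mul1r -t1 mulr_suml; apply: eq_bigr => i _.
by rewrite mxE ts -[in RHS](vv' i); ring.
Qed.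

Hypothesis noeth : is_noetherian R.
Hypothesis frac_ex : forall y : Q,
  exists a s u, u * toQ s = 1 /\ toQ s * y = toQ a.

Lemma vN_sum (x x' y : Q) : x * x' * x = x -> exists c d,
  x = c * (x + (1 - x * x') * y) /\ y = d * (x + (1 - x * x') * y).
Proof.
move=> ex; exists (x * x'), (y * x' * (x * x') + 1 - x * x'); split.
  have -> : x * x' * (x + (1 - x * x') * y)
      = x + (x * x' * x - x) * (1 - x' * y) by ring.
  by rewrite ex subrr mul0r addr0.
have -> : (y * x' * (x * x') + 1 - x * x') * (x + (1 - x * x') * y)
    = y + (x * x' * x - x) * ((1 - x' * y) * (y * x' - 1)) by ring.
by rewrite ex subrr mul0r addr0.
Qed.

(** Over a von Neumann regular ring any two elements [x], [y] are multiples of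
    [x + (1 - e) y], with [e] the idempotent that generates [x Q]; so a vector whose
    first coordinate generates a maximal ideal among these generates them all. *)
Lemma submodule_pivot n (K : submodule 'rV[Q]_n.+1) :
  exists2 v, carrier K v & forall r, carrier K r -> exists q, r 0 0 = q * v 0 0.
Proof.
have num0 q : exists c, toQ 0 = c * q by exists 0; rewrite rmorph0 mul0r.
have numP q a x y : (exists c, toQ x = c * q) -> (exists c, toQ y = c * q) ->
    exists c, toQ (a * x + y) = c * q.
  move=> [c ex] [d ey]; exists (toQ a * c + d).
  by rewrite rmorphD rmorphM /= ex ey mulrDl mulrA.
pose N q := mk_ideal (A := [set a | exists c, toQ a = c * q]) (num0 q) (@numP q).
have [|I [[v Kv Iv] Imax]] := noeth_max noeth (P := fun I =>
    exists2 v, carrier K v & carrier I = carrier (N (v 0 0))).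
  by exists (N 0), 0; [exact: carrier0 | rewrite mxE].
exists v => // r Kr; have [v' vv'] := vN_regular (v 0 0).
have [a [s [u [us sr]]]] := frac_ex (r 0 0).
pose w := v + (1 - v 0 0 * v') *: r.
have w0 : w 0 0 = v 0 0 + (1 - v 0 0 * v') * r 0 0 by rewrite !mxE.
have [c [d []]] := vN_sum (r 0 0) vv'; rewrite -w0 => ec ed.
have [q ea] : carrier (N (v 0 0)) a.
  rewrite -Iv; apply: (Imax (N (w 0 0))).
  - by exists w => //; apply: carrierD => //; exact: carrierZ.
  - by rewrite Iv => x [q ex]; exists (q * c); rewrite ex ec mulrA.
  - by exists (toQ s * d); rewrite -sr {1}ed mulrA.
by exists (u * q); rewrite -mulrA -ea -sr mulrA us mul1r.
Qed.

(** The first coordinate of a pivot [v] generates those of all of [K], which splits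
    [K] into [Q v] and the vectors with zero first coordinate.  Integrality of [P]
    means that the integral points of [K] are a direct summand of the free module
    over the integral closure. *)
Lemma integral_projector n (K : submodule 'rV[Q]_n) : exists P : 'M[Q]_n,
  [/\ forall i j, integral (P i j), forall i, carrier K (row i P) &
      forall r, carrier K r -> r *m P = r].
Proof.
elim: n K => [|n IHn] K.
  exists 0; split; [by case | by case | by move=> r _; rewrite !thinmx0].
have K0 : carrier K (row_mx (0 : 'rV_1) (0 : 'rV_n)).
  by rewrite row_mx0; exact: carrier0.
have KP q (r t : 'rV_n) : carrier K (row_mx (0 : 'rV_1) r) ->
    carrier K (row_mx (0 : 'rV_1) t) -> carrier K (row_mx (0 : 'rV_1) (q *: r + t)).
  have -> : row_mx 0 (q *: r + t) = q *: row_mx 0 r + row_mx 0 t :> 'rV_(1 + n).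
    by rewrite scale_row_mx add_row_mx scaler0 addr0.
  exact: (@carrierP _ _ K).
pose K' : submodule 'rV_n :=
  @Submodule _ 'rV_n [set r | carrier K (row_mx (0 : 'rV_1) r)] K0 KP.
have [P' [intP' KP' P'K]] := IHn K'.
pose P2 : 'M[Q]_(1 + n) := block_mx 0 0 0 P'.
have KP2 (r : 'rV_(1 + n)) : carrier K (r *m P2).
  rewrite -[r](@hsubmxK _ 1 1 n) mul_row_block !mulmx0 !add0r.
  rewrite [_ *m P']mulmx_sum_row; apply: (@carrier_sum _ _ K').
  by move=> i _; apply: carrierZ; exact: KP'.
have P2K (r : 'rV_(1 + n)) : carrier K r -> r 0 0 = 0 -> r *m P2 = r.
  move=> Kr r0; move: Kr; rewrite -[r](@hsubmxK _ 1 1 n).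
  have -> : @lsubmx _ 1 1 n r = 0.
    apply/matrixP => i j; rewrite !ord1 !mxE -[RHS]r0; congr (r _ _).
    exact/val_inj.
  by move=> Kr; rewrite mul_row_block !mulmx0 !add0r (P'K _ Kr).
have P2_0 (r : 'rV_(1 + n)) : (r *m P2) 0 0 = 0.
  rewrite -[r](@hsubmxK _ 1 1 n) mul_row_block !mulmx0 !add0r mxE.
  by case: splitP => j //; rewrite mxE.
have [v0 Kv0 v0K] := submodule_pivot K.
(* Once [v] is killed by [P2], the two projectors combine. *)
pose v := v0 - v0 *m P2.
have Kv : carrier K v by apply: carrierB => //; exact: KP2.
have v00 : v 0 0 = v0 0 0 by rewrite [LHS]mxE [X in _ + X]mxE P2_0 subr0.
have vP2 : v *m P2 = 0 by rewrite mulmxBl (P2K (v0 *m P2)) ?subrr //; exact: KP2.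
have [P1 [intP1 vP1 P1v]] := rank_one_projector v.
exists (P2 + (1%:M - P2) *m P1); split.
- have intP2 i j : integral (P2 i j).
    rewrite /P2 /block_mx mxE.
    by case: (fintype.split i) => k; rewrite mxE; case: (fintype.split j) => l;
      rewrite ?mxE //; exact: integral0.
  move=> i j; rewrite mxE; apply: integral_add => //.
  rewrite mxE; apply: integral_sum => k _; apply: integral_mul => //.
  rewrite mxE [X in _ + X]mxE [X in X - _]mxE; apply: integral_sub => //.
  exact: integral_nat.
- move=> i; rewrite raddfD /= rowE; apply: carrierD => //.
  rewrite row_mul mulmx_sum_row; apply: carrier_sum => k _.
  by have [q ->] := vP1 k; do 2!apply: carrierZ.
move=> r Kr; have [q rq] := v0K r Kr.
pose t := r - q *: v; have rE : r = q *: v + t by rewrite addrC subrK.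
have Kt : carrier K t by apply: carrierB => //; exact: carrierZ.
have t0 : t 0 0 = 0.
  by rewrite [LHS]mxE [X in _ + X]mxE [X in _ - X]mxE v00 rq subrr.
have fixP (u : 'rV_n.+1) : u *m (P2 + (1%:M - P2) *m P1)
    = u *m P2 + (u - u *m P2) *m P1.
  by rewrite mulmxDr mulmxA mulmxBr mulmx1.
have rP2 : (q *: v + t) *m P2 = t.
  by rewrite mulmxDl (P2K t Kt t0) -scalemxAl vP2 scaler0 add0r.
by rewrite rE fixP rP2 addrK -scalemxAl P1v addrC.
Qed.

End IntegralClosure.

(** * Factoring the conductor through free modules *)

Definition torsion_free (R : comNzRingType) (M : lmodType R) : Prop :=
  forall s (x : M), nonzerodiv_set R s -> s *: x = 0 -> x = 0.

Section ConductorFactor.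
Variables (R : comNzRingType) (m : ideal R).
Hypotheses (noeth : is_noetherian R) (loc_m : is_local m) (red : is_reduced R).
Hypothesis dim1 : krull_dim R 1.
Local Notation Q := (total_frac R).
Local Notation toQ := (@to_total_frac R).

(** [x R + ann x] is faithful because [R] is reduced, so it contains a nonzerodivisor
    [u x + t] with [t x = 0]. *)
Lemma total_frac_vN_regular (a : Q) : exists a', a * a' * a = a.
Proof.
have [x [s [sreg sa]]] := total_frac_ex a.
have ann0 : 0 * x = 0 by rewrite mul0r.
have annP b y z : y * x = 0 -> z * x = 0 -> (b * y + z) * x = 0.
  by move=> yx zx; rewrite mulrDl -mulrA yx zx mulr0 addr0.
pose annx := mk_ideal (A := [set y | y * x = 0]) ann0 annP.
have [|z [u [t [tx ->]]] zreg] :=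
    faithful_ideal_nonzerodiv noeth red (I := ideal_adj annx x).
  move=> z zI; have zx0 := zI _ (mem_ideal_adj annx x).
  by apply: (red (n := 2)); rewrite expr2; apply/zI/sub_ideal_adj.
have {}tx : t * x = 0 by [].
have [w w1] := total_frac_unit zreg.
exists (toQ s * toQ u * w); apply: (total_frac_reg sreg).
rewrite (_ : _ * _ = w * toQ u * (toQ s * a) * (toQ s * a)); last by ring.
rewrite sa -[RHS]mul1r -w1 -!mulrA -!rmorphM; congr (w * toQ _).
by rewrite mulrDl tx addr0 mulrA.
Qed.

Lemma total_frac_integral_projector n (K : submodule 'rV[Q]_n) :
  exists P : 'M[Q]_n, [/\ forall i j, integral_closure R (P i j),
    forall i, carrier K (row i P) & forall r, carrier K r -> r *m P = r].
Proof.
apply: (@integral_projector R Q toQ) => //.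
- exact: (unit_relation noeth loc_m red dim1).
- exact: total_frac_vN_regular.
move=> y; have [a [s [sreg sy]]] := total_frac_ex y.
by have [u us] := total_frac_unit sreg; exists a, s, u.
Qed.

Lemma map_toQ_inj n : injective (map_mx toQ : 'rV[R]_n -> 'rV[Q]_n).
Proof.
move=> u v /rowP uv; apply/rowP => i.
by have := uv i; rewrite !mxE; exact: to_total_frac_inj.
Qed.

(** Over the integral closure the lattice generated by [M] is a direct summand of a
    finite free module, and the conductor brings the coordinates of the splitting
    back into [R]. *)
Lemma conductor_factor (M : lmodType R) c : finitely_generated M ->
  torsion_free M -> conductor R (toQ c) ->
  exists s : {linear M -> {malg R[M]}}, forall x, free_cover M (s x) = c *: x.
Proof.
move=> [g gM] tfM cC; pose n := size g.
pose comb (r : 'rV[R]_n) : M := \sum_i r 0 i *: g`_i.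
have combP a r t : comb (a *: r + t) = a *: comb r + comb t.
  rewrite /comb scaler_sumr -big_split; apply: eq_bigr => i _ /=.
  by rewrite !mxE scalerDl scalerA.
have comb0 : comb 0 = 0 by rewrite /comb big1 // => i _; rewrite mxE scale0r.
have combZ a r : comb (a *: r) = a *: comb r.
  by rewrite -[a *: r]addr0 combP comb0 addr0.
have K0 : exists d rho, [/\ nonzerodiv_set R d,
    map_mx toQ rho = toQ d *: (0 : 'rV[Q]_n) & comb rho = 0].
  by exists 1, 0; split; [exact: nonzerodiv1 | rewrite map_mx0 scaler0 |].
have KP (a : Q) (r t : 'rV[Q]_n) :
    (exists d rho, [/\ nonzerodiv_set R d,
      map_mx toQ rho = toQ d *: r & comb rho = 0]) ->
    (exists d rho, [/\ nonzerodiv_set R d,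
      map_mx toQ rho = toQ d *: t & comb rho = 0]) ->
    exists d rho, [/\ nonzerodiv_set R d,
      map_mx toQ rho = toQ d *: (a *: r + t) & comb rho = 0].
  move=> [d [rho [dreg erho rho0]]] [d' [rho' [dreg' erho' rho0']]].
  have [b [s [sreg sa]]] := total_frac_ex a.
  exists (s * d * d'), ((b * d') *: rho + (s * d) *: rho'); split.
  - by do 2?apply: nonzerodivM.
  - rewrite map_mxD !map_mxZ /= erho erho' !rmorphM /= -sa scalerDr !scalerA.
    by congr (_ *: _ + _ *: _); ring.
  - by rewrite combP combZ rho0 rho0' !scaler0 addr0.
(* The relations over [Q] between the generators; [c (1 - P)] has entries in [R],
   kills the relations and is [c] modulo relations. *)
pose K : submodule 'rV[Q]_n := @Submodule _ 'rV[Q]_n [set r | _] K0 KP.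
have [P [intP KP' P'K]] := total_frac_integral_projector K.
have gamP (ij : 'I_n * 'I_n) : exists r : R,
    toQ r = toQ c * (1%:M - P) ij.1 ij.2.
  have [|r _ e] := cC ((1%:M - P) ij.1 ij.2); last by exists r.
  rewrite mxE [X in _ + X]mxE [X in X - _]mxE; apply: integral_sub.
    exact: integral_nat.
  exact: intP.
have [gam gamE] := choice gamP; pose G := \matrix_(i, j) gam (i, j).
have GE : map_mx toQ G = toQ c *: (1%:M - P).
  by apply/matrixP => i j; rewrite [LHS]mxE [in LHS]mxE gamE [RHS]mxE.
have kerG r : comb r = 0 -> r *m G = 0.
  move=> r0; apply: map_toQ_inj; rewrite map_mx0 map_mxM GE -scalemxAr.
  rewrite mulmxBr mulmx1 P'K ?subrr ?scaler0 //.
  by exists 1, r; split=> //; [exact: nonzerodiv1 | rewrite rmorph1 scale1r].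
have combG r : comb (r *m G) = c *: comb r.
  have [d [rho [dreg erho rho0]]] : carrier K (map_mx toQ (r *m G - c *: r)).
    rewrite map_mxB map_mxM map_mxZ GE -scalemxAr mulmxBr mulmx1 scalerBr.
    rewrite addrAC subrr add0r -scaleNr; apply: carrierZ.
    by rewrite mulmx_sum_row; apply: carrier_sum => i _; exact: carrierZ.
  have {}erho : rho = d *: (r *m G - c *: r).
    by apply: map_toQ_inj; rewrite erho map_mxZ.
  apply/eqP; rewrite -subr_eq0; apply/eqP/(tfM d) => //.
  have combB : comb (r *m G - c *: r) = comb (r *m G) - c *: comb r.
    by rewrite addrC -scaleNr combP scaleNr addrC.
  by rewrite -combB -combZ -erho.
have /choice[rep repE] x : exists r, x = comb r.
  have /span_seqP[a ->] : carrier (span [set` g]) x by rewrite gM.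
  by exists (\row_i a i); apply: eq_bigr => i _; rewrite mxE.
pose s x : {malg R[M]} := \sum_i (rep x *m G) 0 i *: << g`_i >>.
have lin_s : linear s.
  move=> a x y; rewrite /s scaler_sumr -big_split; apply: eq_bigr => i _ /=.
  rewrite scalerA -scalerDl; congr (_ *: _).
  have : comb (rep (a *: x + y) - (a *: rep x + rep y)) = 0.
    by rewrite addrC -scaleN1r combP combP -!repE scaleN1r addNr.
  move/kerG; rewrite mulmxBl mulmxDl -scalemxAl => /eqP; rewrite subr_eq0.
  by move=> /eqP ->; rewrite !mxE.
exists (linear_of lin_s) => x; rewrite linear_ofE /s linear_sum.
rewrite [in RHS](repE x) -combG; apply: eq_bigr => i _.
by rewrite linearZ /= /free_cover /= free_extU.
Qed.

End ConductorFactor.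

(** * Homotopies on the standard resolution *)

Section HomologyAnn.
Variables (R : comNzRingType).

Lemma ann_homologyP (A B C : lmodType R) (f : {linear A -> B})
    (g : {linear B -> C}) c :
  ann (homology f g) c <-> forall x, g x = 0 -> exists y, f y = c *: x.
Proof.
split=> [annc x gx|fg u].
  have kx : in_submodule (ker g) x by apply/asboolP.
  have /quotmod_piP : quotmod_pi (boundary f g) (c *: Sub x kx) =
      quotmod_pi (boundary f g) 0.
    by rewrite linearZ /= annc linear0.
  by rewrite subr0 => -[y e]; exists y; rewrite e linearZ.
rewrite -[u]quotmod_reprK -linearZ -(linear0 (quotmod_pi (boundary f g))).
apply/quotmod_piP; rewrite subr0; set z := repr _.
have [|y e] := fg (val z); first exact/asboolP/(svalP z).
by exists y; rewrite e linearZ.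
Qed.

Lemma free_ext_ext (X : choiceType) (M : lmodType R)
    (f g : {linear {malg R[X]} -> M}) :
  (forall x, f << x >> = g << x >>) -> forall u, f u = g u.
Proof.
move=> fg u; rewrite (monalgE u) !linear_sum; apply: eq_bigr => k _.
have -> : << u@_k *g k >> = u@_k *: << k >>.
  by apply/malgP => j; rewrite mcoeffZ !mcoeffU mulrnAr mulr1.
by rewrite !linearZ /= fg.
Qed.

Lemma tensor_ext (M N P : lmodType R) (f g : {linear tensor M N -> P}) :
  (forall x y, f (tmk x y) = g (tmk x y)) -> forall t, f t = g t.
Proof.
move=> fg t; rewrite -[t]quotmod_reprK.
pose q : {linear {malg R[(M * N)%type]} -> tensor M N} :=
  quotmod_pi (span (@tensor_rel R M N)).
apply: (@free_ext_ext _ _ (f \o q : {linear _ -> _}) (g \o q : {linear _ -> _})).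
by move=> [x y] /=; exact: fg.
Qed.

End HomologyAnn.

Section Homotopy.
Variables (R : comNzRingType) (c : R).

(** As every map from a free module to [M] lifts to the free cover, this says that
    multiplication by [c] on [M] factors through some free module. *)
Definition scale_factors (M : lmodType R) : Prop :=
  exists s : {linear M -> {malg R[M]}}, forall x, free_cover M (s x) = c *: x.

Lemma scale_factors_homotopy (M : lmodType R)
    (s : {linear M -> {malg R[M]}}) :
  (forall x, free_cover M (s x) = c *: x) ->
  exists h : {linear {malg R[M]} -> {malg R[submod (ker (free_cover M))]}},
    forall u, val (free_cover _ (h u)) = c *: u - s (free_cover M u).
Proof.
move=> sP; have ks x : in_submodule (ker (free_cover M)) (c *: << x >> - s x).
  apply/asboolP; change (free_cover M (c *: << x >> - s x) = 0).
  by rewrite linearB linearZ /= free_extU sP subrr.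
pose h : {linear {malg R[M]} -> {malg R[submod (ker (free_cover M))]}} :=
  free_ext (fun x => << Sub _ (ks x) : submod _ >>).
exists h => u; pose l : {linear {malg R[M]} -> {malg R[M]}} :=
  val \o free_cover (submod (ker (free_cover M))) \o h.
pose r : {linear {malg R[M]} -> {malg R[M]}} :=
  (c \*: idfun) \- (s \o free_cover M).
apply: (@free_ext_ext _ _ _ l r).
move=> x; rewrite /l /r /= /h /free_cover /=.
by rewrite !free_extU.
Qed.

(** On the syzygy the homotopy is a section of the next cover, up to [c]. *)
Lemma scale_factors_contract (M : lmodType R) : scale_factors M ->
  exists k : {linear {malg R[M]} -> {malg R[submod (ker (free_cover M))]}},
    forall z : submod (ker (free_cover M)), free_cover _ (k (val z)) = c *: z.
Proof.
move=> [s sP]; have [h hP] := scale_factors_homotopy sP.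
exists h => z; apply: val_inj; rewrite hP linearZ.
have -> : free_cover M (val z) = 0 by exact/asboolP/(svalP z).
by rewrite linear0 subr0.
Qed.

Lemma scale_factors_syzygy (M : lmodType R) : scale_factors M ->
  forall n, scale_factors (syzygy M n).
Proof.
move=> sM; elim=> [//|n /scale_factors_contract[k kP]].
by exists (k \o val : {linear _ -> _}).
Qed.

(** The map [k] restricts to the section on the next syzygy from which [h] is built,
    which is why their contributions match. *)
Lemma resolution_homotopy (M : lmodType R) n : scale_factors M ->
  exists (h : {linear resolution M n.+1 -> resolution M n.+2})
         (k : {linear resolution M n -> resolution M n.+1}),
    forall u, resolution_d M n.+2 (h u) + k (resolution_d M n.+1 u) = c *: u.
Proof.
move=> sM; have [k kP] := scale_factors_contract (scale_factors_syzygy sM n).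
have [h hP] := scale_factors_homotopy (s := k \o val : {linear _ -> _}) kP.
by exists h, k => u; rewrite /= hP subrK.
Qed.

Lemma scale_factors_ann_Tor (M N : lmodType R) i : scale_factors M ->
  ann (Tor i.+1 M N) c.
Proof.
move=> sM; have [h [k hk]] := resolution_homotopy i sM.
apply/ann_homologyP => t dt; exists (tensor_map N h t).
pose l : {linear tensor (resolution M i.+1) N -> tensor (resolution M i.+1) N} :=
  (tensor_map N (resolution_d M i.+2) \o tensor_map N h)
  \+ (tensor_map N k \o tensor_map N (resolution_d M i.+1)).
pose r : {linear tensor (resolution M i.+1) N -> tensor (resolution M i.+1) N} :=
  c \*: idfun.
rewrite -[RHS]/(r t) -(@tensor_ext _ _ _ _ l r) /l /=.
  by rewrite dt linear0 addr0.
by move=> x y; rewrite /l /r /= !tensor_mapE -tmkDl hk tmkZl.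
Qed.

Lemma scale_factors_ann_Ext (M N : lmodType R) i : scale_factors M ->
  ann (Ext i.+1 M N) c.
Proof.
move=> sM; have [h [k hk]] := resolution_homotopy i sM.
apply/ann_homologyP => f df; exists (hom_map N k f).
apply/val_inj/funext => u.
have lf : linear (val f) by exact/asboolP/(svalP f).
have {}df : val f (resolution_d M i.+2 (h u)) = 0.
  by have /(congr1 (fun g => val g (h u))) := df.
have fD x y : val f (x + y) = val f x + val f y.
  by have := lf 1 x y; rewrite !scale1r.
have fZ x : val f (c *: x) = c *: val f x.
  have f0 : val f 0 = 0 by apply: (addrI (val f 0)); rewrite -fD !addr0.
  by have := lf c x 0; rewrite f0 !addr0.
rewrite -[LHS]/(val f (k (resolution_d M i.+1 u))) -[RHS]/(c *: val f u).
by rewrite -fZ -hk fD df add0r.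
Qed.

End Homotopy.

(** * Modules over fields and localized modules *)

Section FieldModules.
Variables (A : comNzRingType) (V : lmodType A).

Lemma bij_of_inj_surj (T U : Type) (f : T -> U) :
  injective f -> (forall y, exists x, f x = y) -> bijective f.
Proof.
move=> inj_f /choice[g fg]; exists g => // x.
by apply: inj_f; rewrite fg.
Qed.

(** A generating family of minimal length is a basis. *)
Lemma fg_free_over_field : (forall a : A, a <> 0 -> exists u, u * a = 1) ->
  finitely_generated V -> is_free V.
Proof.
move=> inv [s0 s0V].
pose gen n := `[< exists2 s : seq V, size s = n & carrier (span [set` s]) = setT >].
have ex_n : exists n, gen n by exists (size s0); apply/asboolP; exists s0.
case: (ex_minnP ex_n) => n /asboolP[s sn sV] n_min.
pose g (i : 'I_n) := s`_i.
pose f : {linear {malg A['I_n]} -> V} := free_ext g.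
exists 'I_n, f; apply: bij_of_inj_surj => [u v uv|x]; last first.
  have /span_seqP[c ->] : carrier (span [set` s]) x by rewrite sV.
  exists (\sum_(i < n) c i *: << i >>); rewrite linear_sum sn.
  by apply: eq_bigr => i _; rewrite linearZ /= free_extU.
apply/eqP; rewrite -subr_eq0; apply: contraT => uv0.
have {uv} fw0 : f (u - v) = 0 by rewrite linearB uv subrr.
set w := u - v in uv0 fw0.
have [i wi] : exists i, w@_i != 0.
  apply: contrapT => nw; case/eqP: uv0; apply/malgP => i; rewrite mcoeff0.
  by apply: contrapT => /eqP wi; apply: nw; exists i.
pose e := rem i (enum 'I_n); pose s' := [seq g j | j <- e].
have Gj j : j != i -> carrier (span [set` s']) (g j).
  move=> ji; apply: span_gen; apply: map_f.
  by rewrite mem_rem_uniq ?enum_uniq // inE ji mem_enum.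
have Gi : carrier (span [set` s']) (g i).
  have [|c ci] := inv w@_i; first exact/eqP.
  move: fw0; rewrite /f /= /free_ext (bigD1_seq i) ?fset_uniq //=; last first.
    by rewrite -mcoeff_neq0.
  move/eqP; rewrite addr_eq0 => /eqP fw.
  rewrite -[g i]scale1r -ci -scalerA fw; apply/carrierZ/carrierN/carrier_sum.
  by move=> j /Gj; exact: carrierZ.
have : (n <= size s')%N.
  apply: n_min; apply/asboolP; exists s' => //.
  rewrite predeqE => x; split=> // _.
  have /span_seqP[c ->] : carrier (span [set` s]) x by rewrite sV.
  apply: carrier_sum; rewrite sn => j _; apply: carrierZ.
  by have [->|/Gj] := eqVneq j i.
rewrite size_map size_rem ?mem_enum // size_enum_ord.
by case: n i {n_min sn g f u v w uv0 fw0 wi e s' Gj Gi} => [[]|n _] //; rewrite ltnn.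
Qed.

End FieldModules.

Section LocModules.
Variables (R : comNzRingType) (S : mulset R) (M : lmodType R).

Definition mkden s (Ss : mulset_carrier S s) : denom S := Denom (asboolT Ss).

Lemma denP (d : denom S) : mulset_carrier S (dval d).
Proof. exact: asboolW (dvalP d). Qed.

Lemma rfrac_scale a s (x : M) t :
  (rfrac a s : loc S) *: frac x t = frac (a *: x) (denomM s t).
Proof. exact: frac_scale. Qed.

Lemma rfracM a s b t : (rfrac a s : loc S) * rfrac b t = rfrac (a * b) (denomM s t).
Proof. exact: rfrac_mul. Qed.

Lemma frac_eq0 (x : M) (s : denom S) :
  frac x s = 0 <-> exists2 u, mulset_carrier S u & u *: x = 0.
Proof.
rewrite -[0]/(frac 0 (denom1 S)); split.
  move/fracP => [u /= e]; exists (dval u); first exact: denP.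
  by move: e; rewrite scale1r !scaler0.
move=> [u Su ux]; apply/fracP; exists (mkden Su) => /=.
by rewrite scale1r ux !scaler0.
Qed.

Lemma frac_numZ (x : M) s : frac x s = (rfrac 1 s : loc S) *: frac x (denom1 S).
Proof.
rewrite rfrac_scale; apply/fracP; exists (denom1 S) => /=.
by rewrite mulr1 !scale1r.
Qed.

Lemma locmod_fg : finitely_generated M -> finitely_generated (locmod S M).
Proof.
move=> [g gM]; pose g' : seq (locmod S M) := [seq frac x (denom1 S) | x <- g].
exists g'; rewrite predeqE => y; split=> // _.
elim/frac_ind: y => x s; rewrite frac_numZ; apply: carrierZ.
have fracP1 a (y z : M) : frac (a *: y + z) (denom1 S)
    = (rfrac a (denom1 S) : loc S) *: frac y (denom1 S) + frac z (denom1 S).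
  rewrite rfrac_scale fracD; apply/fracP; exists (denom1 S) => /=.
  by rewrite !mulr1 !scale1r.
have F0 : carrier (span [set` g']) (frac 0 (denom1 S)).
  exact: (@carrier0 _ (locmod S M)).
have FP a y z : carrier (span [set` g']) (frac y (denom1 S)) ->
    carrier (span [set` g']) (frac z (denom1 S)) ->
    carrier (span [set` g']) (frac (a *: y + z) (denom1 S)).
  by move=> Fy Fz; rewrite fracP1; exact: carrierP.
have : carrier (span [set` g]) x by rewrite gM.
apply: (@span_sub _ _ _ (@Submodule _ M [set z | _] F0 FP)) => z /= zg.
by apply: span_gen; apply: map_f.
Qed.

Lemma rfrac_unit a (s : denom S) : mulset_carrier S a ->
  exists u, u * rfrac a s = 1 :> loc S.
Proof.
move=> Sa; exists (rfrac (dval s) (mkden Sa)); rewrite rfracM.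
by apply/rfracP; exists (denom1 S) => /=; rewrite !mul1r !mulr1 mulrC.
Qed.

End LocModules.

(** * Primes and depth in a localization *)

Section LocIdeals.
Variables (R : comNzRingType) (p : primeSpec R).
Local Notation Rp := (loc_at p).
Local Notation S := (prime_compl p).
Local Notation den := (denom S).
Implicit Types (I : ideal R) (J : ideal Rp).

Lemma mem_rfrac J a (s : den) :
  carrier J (rfrac a s : Rp) <-> carrier J (to_loc S a : Rp).
Proof.
split=> Ja.
  have -> : to_loc S a = rfrac (dval s) (denom1 S) * rfrac a s :> Rp.
    rewrite -[RHS]/(loc_mul _ _) rfrac_mul.
    by apply/rfracP; exists (denom1 S) => /=; rewrite !mul1r mulrC.
  exact: idealMl.
have -> : rfrac a s = rfrac 1 s * to_loc S a :> Rp.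
  rewrite -[RHS]/(loc_mul _ _) rfrac_mul.
  by apply/rfracP; exists (denom1 S) => /=; rewrite !mul1r mulr1.
exact: idealMl.
Qed.

Lemma contract0 J : carrier J (to_loc S 0 : Rp).
Proof. by rewrite rmorph0; exact: carrier0. Qed.

Lemma contractP J a x y : carrier J (to_loc S x : Rp) ->
  carrier J (to_loc S y : Rp) -> carrier J (to_loc S (a * x + y) : Rp).
Proof. by move=> Jx Jy; rewrite rmorphD rmorphM; apply: idealD => //; exact: idealMl. Qed.

Definition contract J : ideal R :=
  mk_ideal (A := [set a | carrier J (to_loc S a : Rp)]) (contract0 J) (@contractP J).

Lemma contract_prime J : prime_ideal J -> prime_ideal (contract J).
Proof.
move=> [J1 JM]; split.
  by move=> J1'; apply: J1; rewrite -(rmorph1 (to_loc S)).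
move=> x y; change (carrier J (to_loc S (x * y) : Rp) ->
  carrier J (to_loc S x : Rp) \/ carrier J (to_loc S y : Rp)).
by rewrite rmorphM => /JM.
Qed.

Lemma contract_lt J J' : carrier J `<` carrier J' ->
  carrier (contract J) `<` carrier (contract J').
Proof.
move=> [JJ' nJ'J]; split=> [a|sub]; first exact: JJ'.
apply: nJ'J; elim/rfrac_ind => a s /mem_rfrac J'a; apply/mem_rfrac.
exact: sub.
Qed.

Lemma contract_chain n c : prime_chain n c ->
  prime_chain n (fun i => contract (c i)).
Proof.
by move=> [cP clt]; split=> i lt_i; [exact/contract_prime/cP | exact/contract_lt/clt].
Qed.

Lemma extend0 I : exists (a : R) (s : den), carrier I a /\ 0 = rfrac a s :> Rp.
Proof. by exists 0, (denom1 S); split; first exact: carrier0. Qed.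

Lemma extendP I (c x y : Rp) :
  (exists (a : R) (s : den), carrier I a /\ x = rfrac a s) ->
  (exists (a : R) (s : den), carrier I a /\ y = rfrac a s) ->
  exists (a : R) (s : den), carrier I a /\ c * x + y = rfrac a s.
Proof.
move=> [a [s [Ia ->]]] [b [t [Ib ->]]]; elim/rfrac_ind: c => c r.
rewrite -[rfrac c r * _]/(loc_mul _ _) rfrac_mul rfracD.
exists (dval t * (c * a) + dval (denomM r s) * b), (denomM (denomM r s) t).
by split=> //; apply: idealD; apply: idealMl => //; exact: idealMl.
Qed.

Definition extend I : ideal Rp := mk_ideal (extend0 I) (@extendP I).

(** The denominators avoid [q], so primality strips them off any representative. *)
Lemma mem_extend q a (s : den) : prime_ideal q ->
  carrier q `<=` carrier (prime_val p) ->
  carrier (extend q) (rfrac a s : Rp) <-> carrier q a.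
Proof.
move=> [q1 qM] qp; split=> [|qa]; last by exists a, s.
move=> [b [t [qb /rfracP[u e]]]].
have nq (d : den) : ~ carrier q (dval d).
  have pd : ~ carrier (prime_val p) (dval d) := denP d.
  by move/qp.
have : carrier q (dval u * (dval t * a)) by rewrite e; do 2!apply: idealMl.
by move=> /qM[/nq//|/qM[/nq//|]].
Qed.

Lemma extend_prime q : prime_ideal q ->
  carrier q `<=` carrier (prime_val p) -> prime_ideal (extend q).
Proof.
move=> qprime qp; split.
  rewrite -[1]/(rfrac 1 (denom1 S)) => /mem_extend; case: qprime => q1 qM.
  by move/(_ (conj q1 qM) qp).
elim/rfrac_ind => a s; elim/rfrac_ind => b t.
rewrite -[_ * _]/(loc_mul _ _) rfrac_mul => /(mem_extend _ _ qprime qp).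
by move=> /qprime.2[qa|qb]; [left|right]; apply/mem_extend.
Qed.

(** An element of [R_p] outside [p R_p] is a unit. *)
Lemma loc_at_local : is_local (extend (prime_val p)).
Proof.
have pp := prime_valP p.
have e1 : ~ carrier (extend (prime_val p)) 1.
  by have [] := extend_prime pp (fun x px => px).
have sub J : ~ carrier J 1 -> carrier J `<=` carrier (extend (prime_val p)).
  move=> J1; elim/rfrac_ind => a s Ja; apply/mem_extend => //.
  apply: contrapT => pa; have [u u1] := @rfrac_unit _ S a s pa.
  by apply: J1; rewrite -u1; exact: idealMl.
split; first by split=> // J _; exact: sub.
move=> m' [m1 m'max]; rewrite eqEsubset; split; first exact: sub.
by apply: m'max => //; exact: sub.
Qed.

Lemma loc_at_max_carrier m' : is_local m' ->
  carrier m' = carrier (extend (prime_val p)).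
Proof. by move=> [mm' _]; exact: loc_at_local.2. Qed.

End LocIdeals.

Section Depth.
Variables (A : comNzRingType) (V : lmodType A) (m : ideal A).
Implicit Types (s : seq A) (a b : A).

Lemma seq_submodule_nil x : carrier (seq_submodule V [::]) x -> x = 0.
Proof.
have z0 : [set 0 : V] 0 by [].
have zP (a : A) (y z : V) : [set 0] y -> [set 0] z -> [set 0 : V] (a *: y + z).
  by move=> -> ->; rewrite scaler0 addr0.
by move/(_ (Submodule z0 zP)); apply=> y [a [z []]].
Qed.

Lemma depth0 (v : V) : v != 0 -> (forall a, carrier m a -> a = 0) ->
  depth V m 0.
Proof.
move=> v0 m0; split.
  exists [::] => //; split=> //; split=> // sT.
  by case/eqP: v0; apply: seq_submodule_nil; rewrite sT.
move=> [|a s] // [ms [sreg _]]; case/eqP: v0; apply: seq_submodule_nil.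
have := sreg 0%N isT v; rewrite take0 /=; apply.
by rewrite (m0 a) ?scale0r; [exact: carrier0 | apply: ms; rewrite mem_head].
Qed.

(** A regular sequence cannot begin with [c, b]: a power of [b] annihilates
    [V / c V], on which [b] would be injective, so that [V = c V]. *)
Lemma depth1 a (v : V) : carrier m a -> (forall x : V, a *: x = 0 -> x = 0) ->
  (forall x : V, v <> a *: x) ->
  (forall a b, carrier m a -> carrier m b ->
    (forall x : V, a *: x = 0 -> x = 0) ->
    exists k, forall x : V, exists y, b ^+ k *: x = a *: y) ->
  depth V m 1.
Proof.
move=> ma areg va mpow.
have sub1 c x : carrier (seq_submodule V [:: c]) x <-> exists y, x = c *: y.
  have z0 : exists y : V, 0 = c *: y by exists 0; rewrite scaler0.
  have zP (d : A) (x1 x2 : V) : (exists y, x1 = c *: y) ->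
      (exists y, x2 = c *: y) -> exists y, d *: x1 + x2 = c *: y.
    move=> [y ->] [z ->]; exists (d *: y + z).
    by rewrite scalerDr !scalerA [d * c]mulrC.
  split=> [/(_ (Submodule z0 zP))|[y ->]].
    by apply=> y [d [z []]]; rewrite inE => /eqP -> ->; exists z.
  by apply: span_gen; exists c, y; rewrite mem_head.
split.
  exists [:: a] => //; split=> [c|]; first by rewrite inE => /eqP ->.
  split=> [[|//] _ x|sT]; last first.
    have /sub1[x] : carrier (seq_submodule V [:: a]) v by rewrite sT.
    exact: va.
  rewrite take0 /= => /seq_submodule_nil/areg ->; exact: carrier0.
move=> [|c [|b s]] // [ms [sreg sT]]; case: sT.
have [||x cx|k kP] := mpow c b.
- by apply: ms; rewrite mem_head.
- by apply: ms; rewrite !inE eqxx orbT.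
- apply: seq_submodule_nil; have := sreg 0%N isT x; rewrite take0 /=; apply.
  by rewrite cx; exact: carrier0.
rewrite predeqE => x; split=> // _.
have : carrier (seq_submodule V [:: c]) x.
  have : carrier (seq_submodule V [:: c]) (b ^+ k *: x).
    by apply/sub1; exact: kP.
  elim: k {kP} => [|k IHk]; first by rewrite expr0 scale1r.
  by rewrite exprS -scalerA => /(sreg 1%N isT)/IHk.
move=> /sub1[y ->]; apply: span_gen; exists c, y; by rewrite mem_head.
Qed.

End Depth.

(** * Maximal Cohen--Macaulay modules in dimension one *)

Section CohenMacaulay.
Variables (R : comNzRingType) (m : ideal R).
Hypotheses (noeth : is_noetherian R) (loc_m : is_local m) (red : is_reduced R).
Hypothesis dim1 : krull_dim R 1.

Lemma loc_nonmax_field (p : primeSpec R) : ~ maximal_ideal (prime_val p) ->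
  forall a : loc_at p, a <> 0 -> exists u, u * a = 1.
Proof.
move=> npmax; elim/rfrac_ind => a s a0.
have [pa|npa] := pselect (carrier (prime_val p) a); last exact: rfrac_unit.
have [t pt ta] := nonmax_prime_kills noeth loc_m red dim1 (prime_valP p) npmax pa.
by case: a0; apply/(@frac_eq0 _ _ R^o); exists t.
Qed.

Lemma field_ideal0 (A : comNzRingType) (J : ideal A) :
  (forall a : A, a <> 0 -> exists u, u * a = 1) -> ~ carrier J 1 ->
  forall a, carrier J a -> a = 0.
Proof.
move=> inv J1 a Ja; apply: contrapT => /inv[u u1]; apply: J1.
by rewrite -u1; exact: idealMl.
Qed.

Lemma krull_dim_field (A : comNzRingType) :
  (forall a : A, a <> 0 -> exists u, u * a = 1) -> krull_dim A 0.
Proof.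
move=> inv; split.
  exists (fun=> zero_ideal A); split=> // i _; split=> [/eqP|x y xy0].
    by rewrite oner_eq0.
  have [x0|x0] := pselect (x = 0); [by left | right].
  have [u u1] := inv x x0.
  by rewrite -[y]mul1r -u1 -mulrA (xy0 : x * y = 0) mulr0; exact: carrier0.
move=> [|n] // c [cP clt]; have [_ []] := clt 0%N isT.
have [c1 _] := cP 1%N isT => a /(field_ideal0 inv c1) ->; exact: carrier0.
Qed.

Section AtMax.
Variable p : primeSpec R.
Hypothesis pm : carrier (prime_val p) = carrier m.

Lemma krull_dim_loc_max : krull_dim (loc_at p) 1.
Proof.
split; last by move=> n c /contract_chain; exact: dim1.2.
have [[c [cP clt]] _] := dim1.
have cp i : (i <= 1)%N -> carrier (c i) `<=` carrier (prime_val p).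
  by move=> /cP[c1 _]; rewrite pm; exact: proper_sub_max.
exists (fun i => extend p (c i)); split=> i lt_i.
  by apply: extend_prime; [exact: cP | exact: cp].
have [sub nsub] := clt i lt_i; split.
  by move=> y [a [s [ca ->]]]; exists a, s; split=> //; exact: sub.
move=> esub; apply: nsub => x cx.
apply/(mem_extend (p := p) x (denom1 _) (cP i (ltnW lt_i)) (cp i (ltnW lt_i))).
by apply: esub; exists x, (denom1 _).
Qed.

Lemma compl_max_unit s : mulset_carrier (prime_compl p) s -> exists u, u * s = 1.
Proof.
by move=> ps; apply: (local_unit noeth loc_m); rewrite -pm.
Qed.

Lemma frac_max_eq0 (M : lmodType R) (x : M) (s : denom (prime_compl p)) :
  frac x s = 0 -> x = 0.
Proof.
move=> /frac_eq0[u /compl_max_unit[v vu] ux].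
by rewrite -[x]scale1r -vu -scalerA ux scaler0.
Qed.

End AtMax.

Lemma max_primeSpec : exists p : primeSpec R, carrier (prime_val p) = carrier m.
Proof. by exists (PrimeSpec (local_prime loc_m)). Qed.

(** Otherwise a prime would contain [a] and [ann M] but not [b]; it is not maximal,
    so some [s] outside it kills [a], and then [s] kills [M] by regularity of [a]. *)
Lemma regular_power_kills (M : lmodType R) a b : carrier m a -> carrier m b ->
  (forall x : M, a *: x = 0 -> x = 0) ->
  exists k, forall x : M, exists y, b ^+ k *: x = a *: y.
Proof.
move=> ma mb areg; apply: contrapT => nk.
have I0 : ann M 0 by move=> x; rewrite scale0r.
have IP r s t : ann M s -> ann M t -> ann M (r * s + t).
  by move=> sM tM x; rewrite scalerDl -scalerA sM tM scaler0 addr0.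
pose I := mk_ideal I0 IP.
have [|||q [qprime Iq qT]] := @prime_avoiding _ noeth
    [set x | exists n, x = b ^+ n] (ideal_adj I a).
- by exists 0%N.
- by move=> _ _ [n ->] [k ->]; exists (n + k)%N; rewrite exprD.
- move=> _ [c [z [Iz ->]]] [n e]; apply: nk; exists n => x; exists (c *: x).
  by rewrite -e scalerDl (Iz x) addr0 scalerA mulrC.
have nqmax : ~ maximal_ideal q.
  move=> /loc_m.2 qm; apply: (qT b); first by rewrite qm.
  by exists 1%N.
have qa : carrier q a by apply: Iq; exact: mem_ideal_adj.
have [s qs sa] := nonmax_prime_kills noeth loc_m red dim1 qprime nqmax qa.
apply/qs/Iq/sub_ideal_adj => x.
by apply: areg; rewrite scalerA mulrC sa scale0r.
Qed.

Lemma depth_loc_max (M : lmodType R) (p : primeSpec R) m' :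
  carrier (prime_val p) = carrier m -> finitely_generated M -> torsion_free M ->
  in_supp p M -> is_local m' -> depth (locmod_at p M) m' 1.
Proof.
move=> pm fgM tfM [v v0] /loc_at_max_carrier m'E.
have pp := prime_valP p.
have m'P a s : carrier m' (rfrac a s) <-> carrier m a.
  by rewrite m'E -pm; exact: mem_extend.
have [a ma areg] := nonzerodiv_in_max noeth loc_m red dim1.
have [w wa] : exists w : M, forall x : M, w <> a *: x.
  apply: contrapT => nw; case/eqP: v0; elim/frac_ind: v => x s.
  apply/frac_eq0; exists 1; first exact: prime_compl1.
  rewrite scale1r; apply: (Nakayama_principal noeth loc_m fgM ma).
  move=> y; apply: contrapT => ny; apply: nw; exists y => z e; apply: ny.
  by exists z.
refine (@depth1 (loc_at p) (locmod_at p M) m' (rfrac a (denom1 _)) (frac w (denom1 _)) _ _ _ _).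
- exact/m'P.
- elim/frac_ind => x s; rewrite rfrac_scale => /(frac_max_eq0 pm)/(tfM _ _ areg) ->.
  by apply/frac_eq0; exists 1; [exact: prime_compl1 | rewrite scaler0].
- elim/frac_ind => x s; rewrite rfrac_scale => /fracP[u /=].
  rewrite scale1r mul1r => e.
  have [u' u'1] := compl_max_unit pm (denP (denomM u s)).
  apply: (wa (u' *: (dval u *: x))).
  rewrite -[w]scale1r -u'1 -!scalerA e !scalerA; congr (_ *: _); ring.
elim/rfrac_ind => b s; elim/rfrac_ind => c t /m'P mb /m'P mc breg.
have [||x bx|k kP] := @regular_power_kills M b c => //.
  apply: (frac_max_eq0 pm (s := denom1 _)); apply: breg.
  rewrite rfrac_scale bx; apply/frac_eq0; exists 1; first exact: prime_compl1.
  by rewrite scaler0.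
exists k; elim/frac_ind => x r; have [y ky] := kP x.
have cX : exists d, rfrac c t ^+ k = rfrac (c ^+ k) d.
  elim: k {kP ky} => [|k [d IHk]]; first by exists (denom1 _).
  by exists (denomM t d); rewrite exprS IHk rfracM -exprS.
have [d ->] := cX; exists (@frac R (prime_compl p) M (dval s *: y) (denomM d r)).
rewrite !rfrac_scale ky; apply/fracP; exists (denom1 _) => /=.
by rewrite !scale1r !scalerA; congr (_ *: _); ring.
Qed.

(** At the maximal ideal a nonzerodivisor is [M]-regular, and no regular sequence is
    longer; the local rings at the other primes are fields. *)
Lemma torsion_free_CM0 (M : lmodType R) :
  finitely_generated M -> torsion_free M -> CM0 M.
Proof.
move=> fgM tfM; split; last first.
  move=> p npmax; apply: fg_free_over_field; last exact: locmod_fg.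
  exact: loc_nonmax_field.
split=> // p suppM; have [/loc_m.2 pm|npmax] :=
    pselect (maximal_ideal (prime_val p)).
  exists 1%N; split; first exact: krull_dim_loc_max.
  by move=> m' lm'; exact: depth_loc_max.
have inv := loc_nonmax_field npmax; exists 0%N; split.
  exact: krull_dim_field.
move=> m' [[m1 _] _]; have [v v0] := suppM; apply: (depth0 v0).
exact: field_ideal0.
Qed.

(** A power of an [M]-regular element of [m] is a multiple of [s]. *)
Lemma CM0_torsion_free (M : lmodType R) : CM0 M -> torsion_free M.
Proof.
move=> [[fgM CM] _] s x sreg sx; apply: contrapT => x0.
have [p pm] := max_primeSpec.
have supp : in_supp p M.
  by exists (frac x (denom1 _)); apply/eqP => /(frac_max_eq0 pm).
have [d [dimp depthp]] := CM p supp.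
have d1 : d = 1%N.
  have [[c cP] dmax] := dimp; have [[c' cP'] dmax'] := krull_dim_loc_max pm.
  by apply/eqP; rewrite eqn_leq (dmax' _ _ cP) (dmax _ _ cP').
have [[t [tm [treg _]] st] _] := depthp _ (loc_at_local p).
case: t st tm treg => [|a [|? ?]] /=; rewrite d1 // => _ am areg.
have {am} : carrier (extend p (prime_val p)) a by apply: am; rewrite mem_head.
elim/rfrac_ind: a areg => a r areg /(mem_extend _ _ (prime_valP p) (fun y py => py)).
rewrite pm => ma; have [k [c ak]] := power_in_principal noeth loc_m red dim1 sreg ma.
have {areg} areg (y : M) : a *: y = 0 -> y = 0.
  move=> ay; apply: (frac_max_eq0 pm (s := denom1 _)).
  apply: seq_submodule_nil; have := areg 0%N isT (frac y (denom1 _)).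
  rewrite take0 /=; apply; rewrite rfrac_scale ay.
  rewrite (_ : frac _ _ = 0); first exact: carrier0.
  by apply/frac_eq0; exists 1; [exact: prime_compl1 | rewrite scaler0].
apply: x0; have : a ^+ k *: x = 0 by rewrite ak -scalerA sx scaler0.
elim: k {ak} => [|k IHk]; first by rewrite expr0 scale1r.
by rewrite exprS -scalerA => /areg.
Qed.

End CohenMacaulay.

(** * Linear maps, tensor products, submodules of free modules *)

Section LinearTools.
Variable R : comNzRingType.

(** [alpha] factors through the cover, hence is additive on generators. *)
Lemma factor_free_cover (Z V : lmodType R) (alpha : {linear {malg R[Z]} -> V}) :
  (forall f, free_cover Z f = 0 -> alpha f = 0) ->
  exists abar : {linear Z -> V}, forall z, alpha << z >> = abar z.
Proof.
move=> alpha0; have lin : linear (fun z : Z => alpha << z >>).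
  move=> a u v; apply/eqP; rewrite -subr_eq0 -linearP -linearB; apply/eqP/alpha0.
  by rewrite linearB linearP /free_cover /= !free_extU subrr.
by exists (linear_of lin).
Qed.

Lemma corestrict_subproof (A B : lmodType R) (S : submodule B)
    (f : {linear A -> B}) (fS : forall x, carrier S (f x)) x :
  in_submodule S (f x).
Proof. exact/asboolP. Qed.

Lemma corestrict_linear (A B : lmodType R) (S : submodule B)
    (f : {linear A -> B}) (fS : forall x, carrier S (f x)) :
  linear (fun x => Sub (f x) (corestrict_subproof fS x) : submod S).
Proof. by move=> a x y; apply: val_inj; exact: linearP. Qed.

Definition corestrict (A B : lmodType R) (S : submodule B)
    (f : {linear A -> B}) (fS : forall x, carrier S (f x)) :
    {linear A -> submod S} :=
  linear_of (corestrict_linear fS).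

Lemma carrier_val (B : lmodType R) (S : submodule B) (z : submod S) :
  carrier S (val z).
Proof. exact/asboolP/(svalP z). Qed.

Lemma ker_val (A B : lmodType R) (f : {linear A -> B}) (z : submod (ker f)) :
  f (val z) = 0.
Proof. exact: (carrier_val z). Qed.

Lemma submod_fg (B : lmodType R) (S : submodule B) (s : seq B) :
  carrier S = carrier (span [set` s]) -> finitely_generated (submod S).
Proof.
move=> Ss; have sS v : v \in s -> in_submodule S v.
  by move=> vs; apply/asboolP; rewrite Ss; exact: span_gen.
exists (pmap insub s); rewrite predeqE => u; split=> // _.
have : carrier (span [set` s]) (val u) by rewrite -Ss; exact: carrier_val.
move/span_seqP => [c ec].
have -> : u = \sum_(i < size s) c i *: insubd (0 : submod S) s`_i.
  apply: val_inj; rewrite linear_sum ec; apply: eq_bigr => i _.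
  by rewrite linearZZ /= insubdK //; apply/sS/mem_nth.
apply: carrier_sum => i _; apply/carrierZ/span_gen => /=.
have si : s`_i \in s by exact: mem_nth.
rewrite mem_pmap; apply/mapP; exists s`_i => //.
by rewrite /insubd insubT ?sS.
Qed.

Section TensorLift.
Variables (M N P : lmodType R) (b : M -> N -> P).
Hypothesis b_l : forall y, linear (b^~ y).
Hypothesis b_r : forall x, linear (b x).

Lemma tensor_lift_ex : exists f : {linear tensor M N -> P},
  forall x y, f (tmk x y) = b x y.
Proof.
pose g : {linear {malg R[(M * N)%type]} -> P} := free_ext (fun p => b p.1 p.2).
have gU p : g << p >> = b p.1 p.2 by exact: free_extU.
have b_lB y x x' : b (x + x') y = b x y + b x' y.
  by have := b_l y 1 x x'; rewrite !scale1r.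
have b_rB x y y' : b x (y + y') = b x y + b x y'.
  by have := b_r x 1 y y'; rewrite !scale1r.
have b_l0 y : b 0 y = 0 by apply: (addrI (b 0 y)); rewrite -b_lB !addr0.
have b_r0 x : b x 0 = 0 by apply: (addrI (b x 0)); rewrite -b_rB !addr0.
have b_lZ a x y : b (a *: x) y = a *: b x y.
  by have := b_l y a x 0; rewrite b_l0 !addr0.
have b_rZ a x y : b x (a *: y) = a *: b x y.
  by have := b_r x a y 0; rewrite b_r0 !addr0.
have g0 u : carrier (span (@tensor_rel R M N)) u -> g u = 0.
  apply: (@span_sub _ _ _ (ker g)) => _ [x x' y|x y y'|a x y|a x y];
    rewrite /carrier /= /ker_set /=.
  - by rewrite !linearB !gU /= b_lB [_ + b x' y]addrC addrK subrr.
  - by rewrite !linearB !gU /= b_rB [_ + b x y']addrC addrK subrr.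
  - by rewrite linearB linearZ !gU /= b_lZ subrr.
  - by rewrite linearB linearZ !gU /= b_rZ subrr.
pose f (t : tensor M N) := g (repr (t : Quotient.quot _)).
have f_pi u : f (quotmod_pi _ u) = g u.
  apply/eqP; rewrite -subr_eq0 -linearB; apply/eqP/g0/quotmod_piP.
  exact: quotmod_reprK.
have lf : linear f.
  move=> a u v; rewrite -[u]quotmod_reprK -[v]quotmod_reprK.
  by rewrite -(linearP (quotmod_pi _)) !f_pi linearP.
by exists (linear_of lf) => x y; rewrite linear_ofE f_pi gU.
Qed.

End TensorLift.

Hypothesis noeth : is_noetherian R.

(** Induction on the rank: the first coordinates form an ideal, and the vectors
    whose first coordinate is zero form a submodule of a smaller free module. *)
Lemma noetherian_rV_fg n (T : submodule 'rV[R]_n) :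
  exists g : seq 'rV[R]_n, carrier T = carrier (span [set` g]).
Proof.
elim: n T => [|n IHn] T.
  exists [::]; rewrite predeqE => v.
  by have -> : v = 0 by [rewrite thinmx0]; split=> _; exact: carrier0.
have I0 : exists2 v, carrier T v & v 0 0 = 0.
  by exists 0; [exact: carrier0 | rewrite mxE].
have IP (a x y : R) : (exists2 v, carrier T v & v 0 0 = x) ->
    (exists2 v, carrier T v & v 0 0 = y) ->
    exists2 v, carrier T v & v 0 0 = a * x + y.
  move=> [v Tv <-] [w Tw <-]; exists (a *: v + w); first exact: carrierP.
  by rewrite !mxE.
pose I := @mk_ideal R [set x | _] I0 IP.
have [s Is] := noeth I.
have [gs gsT gss] : exists2 gs : seq 'rV[R]_n.+1, {in gs, forall v, carrier T v} &
    s = [seq v 0 0 | v : 'rV[R]_n.+1 <- gs].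
  have: {in s, forall x, carrier I x} by move=> x xs; rewrite Is; exact: span_gen.
  elim: {Is} s => [|x s IHs] sI; first by exists [::].
  have [gs gsT ->] := IHs (fun y ys => sI y (mem_behead (s := x :: s) ys)).
  have [v Tv <-] := sI x (mem_head _ _); exists (v :: gs) => // w.
  by rewrite inE => /predU1P[->|/gsT].
pose emb (v : 'rV[R]_n) : 'rV[R]_(1 + n) := row_mx 0 v.
have embP a u v : emb (a *: u + v) = a *: emb u + emb v.
  by rewrite /emb scale_row_mx add_row_mx scaler0 addr0.
have T0 : carrier T (emb 0) by rewrite /emb row_mx0; exact: carrier0.
have TP a u v : carrier T (emb u) -> carrier T (emb v) ->
    carrier T (emb (a *: u + v)).
  by move=> Tu Tv; rewrite embP; exact: (@carrierP _ _ T).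
pose T' : submodule 'rV[R]_n := @Submodule _ 'rV[R]_n [set v | _] T0 TP.
have [g' T'g'] := IHn T'; pose g := gs ++ [seq emb v | v <- g'].
exists g; rewrite predeqE => v; split; last first.
  apply: (@span_sub _ _ _ T) => w /=; rewrite mem_cat => /orP[/gsT//|/mapP[u ug' ->]].
  have : carrier T' u by rewrite T'g'; exact: span_gen.
  exact.
move=> Tv; have : carrier I (v 0 0) by exists v.
rewrite Is => /(@span_seqP R R^o)[c]; rewrite gss size_map => v00.
pose w := \sum_(i < size gs) c i *: gs`_i.
have Tw : carrier T w.
  by apply: carrier_sum => i _; apply/carrierZ/gsT/mem_nth.
have -> : v = w + (v - w) by rewrite addrC subrK.
apply: carrierD.
  apply: carrier_sum => i _; apply/carrierZ/span_gen => /=.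
  by rewrite mem_cat mem_nth.
have vw0 : (v - w) 0 0 = 0.
  rewrite !mxE v00 summxE; apply/eqP; rewrite subr_eq0; apply/eqP.
  by apply: eq_bigr => i _; rewrite mxE (nth_map 0).
have vwE : v - w = emb (@rsubmx _ 1 1 n (v - w)).
  apply: etrans (esym (@hsubmxK _ 1 1 n (v - w))) _; congr row_mx.
  apply/matrixP => i j; rewrite !ord1 mxE [RHS]mxE -[RHS]vw0.
  by congr ((v - w) _ _); exact/val_inj.
have : carrier T' (@rsubmx _ 1 1 n (v - w)).
  by change (carrier T (emb (@rsubmx _ 1 1 n (v - w)))); rewrite -vwE; exact: carrierB.
rewrite T'g' => /span_seqP[d ed]; rewrite vwE ed.
have -> : emb (\sum_(i < size g') d i *: g'`_i) = \sum_(i < size g') d i *: emb g'`_i.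
  elim: (size g') => [|k IHk]; first by rewrite !big_ord0 /emb row_mx0.
  by rewrite !big_ord_recr /= -IHk addrC embP addrC.
apply: carrier_sum => i _; apply/carrierZ/span_gen => /=.
by rewrite mem_cat map_f ?orbT // mem_nth.
Qed.

End LinearTools.

(** * Detecting a trace ideal by Tor and Ext *)

Section Detection.
Variables (R : comNzRingType) (n : nat) (T : submodule 'rV[R]_n.+1).

Definition firsts (a : R) : Prop := exists2 t, carrier T t & t 0 0 = a.

(** [T] is a copy of the ideal [firsts], embedded in [R^(n+1)] with torsion-free
    cokernel; [T_trace] says that [firsts] is its own trace ideal, a function [phi]
    as in its premise being the same as a functional on that ideal. *)
Hypothesis noeth : is_noetherian R.
Hypothesis T_prop : forall t t', carrier T t -> carrier T t' ->
  t' 0 0 *: t = t 0 0 *: t'.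
Hypothesis T_reg : exists2 t, carrier T t & nonzerodiv_set R (t 0 0).
Hypothesis T_trace : forall phi : 'rV[R]_n.+1 -> R,
  (forall t t', carrier T t -> carrier T t' -> t' 0 0 * phi t = t 0 0 * phi t') ->
  forall t, carrier T t -> firsts (phi t).
Hypothesis T_sat : forall s v, nonzerodiv_set R s -> carrier T (s *: v) ->
  carrier T v.

Lemma firstsP a x y : firsts x -> firsts y -> firsts (a * x + y).
Proof.
move=> [t Tt <-] [t' Tt' <-]; exists (a *: t + t'); first exact: carrierP.
by rewrite !mxE.
Qed.

Lemma firsts0 : firsts 0.
Proof. by exists 0; [exact: carrier0 | rewrite mxE]. Qed.

Definition firsts_ideal : ideal R := mk_ideal firsts0 firstsP.

Lemma T_prop_coord t t' j : carrier T t -> carrier T t' ->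
  t' 0 0 * t 0 j = t 0 0 * t' 0 j.
Proof. by move=> Tt Tt'; have /rowP/(_ j) := T_prop Tt Tt'; rewrite !mxE. Qed.

Lemma firsts_coord t j : carrier T t -> firsts (t 0 j).
Proof.
move=> Tt; apply: (T_trace (phi := fun t => t 0 j)) => // u v Tu Tv.
exact: T_prop_coord.
Qed.

Definition L_T : lmodType R := quotmod T.
Local Notation F0 := ({malg R[L_T]} : lmodType R).
Local Notation Z1 := (submod (ker (free_cover L_T))).
Local Notation F1 := ({malg R[Z1]} : lmodType R).
Local Notation Z2 := (submod (ker (free_cover Z1))).
Local Notation F2 := ({malg R[Z2]} : lmodType R).

Definition ebase (j : 'I_n.+1) : L_T := quotmod_pi T (delta_mx 0 j).

Lemma quotmod_pi_rV (v : 'rV[R]_n.+1) :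
  quotmod_pi T v = \sum_j v 0 j *: ebase j.
Proof.
by rewrite {1}[v]row_sum_delta linear_sum; apply: eq_bigr => j _; rewrite linearZ.
Qed.

Lemma quotmod_fg_rV k (S : submodule 'rV[R]_k) : finitely_generated (quotmod S).
Proof.
exists [seq quotmod_pi S (delta_mx 0 j) | j <- enum 'I_k].
rewrite predeqE => u; split=> // _; rewrite -[u]quotmod_reprK.
set v := repr _; rewrite [v]row_sum_delta linear_sum; apply: carrier_sum => j _.
by rewrite linearZ; apply/carrierZ/span_gen/map_f; rewrite mem_enum.
Qed.

Lemma L_T_torsion_free : torsion_free L_T.
Proof.
move=> s u sreg; rewrite -[u]quotmod_reprK -linearZ.
rewrite -[0](linear0 (quotmod_pi T)) => /quotmod_piP; rewrite subr0 => Tsu.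
by apply/quotmod_piP; rewrite subr0; exact: T_sat Tsu.
Qed.

Lemma theta_linear_ex : exists theta : {linear F0 -> 'rV[R]_n.+1},
  forall f, quotmod_pi T (theta f) = free_cover L_T f.
Proof.
pose theta : {linear F0 -> 'rV[R]_n.+1} :=
  free_ext (fun u : L_T => repr (u : Quotient.quot (in_submodule T))).
exists theta => f; apply: (@free_ext_ext _ _ _ (quotmod_pi T \o theta : {linear _ -> _})).
by move=> u /=; rewrite /theta /= /free_cover /= !free_extU quotmod_reprK.
Qed.

Lemma sigma_linear : linear (fun v : 'rV[R]_n.+1 =>
  \sum_j v 0 j *: << ebase j >> : F0).
Proof.
move=> a u v; rewrite scaler_sumr -big_split; apply: eq_bigr => j _ /=.
by rewrite !mxE scalerDl scalerA.
Qed.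

Definition sigma : {linear 'rV[R]_n.+1 -> F0} := linear_of sigma_linear.

Lemma sigmaE v : sigma v = \sum_j v 0 j *: << ebase j >>.
Proof. by []. Qed.

Lemma cover_sigma v : free_cover L_T (sigma v) = quotmod_pi T v.
Proof.
rewrite quotmod_pi_rV sigmaE linear_sum; apply: eq_bigr => j _.
by rewrite linearZ /= /free_cover /= free_extU.
Qed.

Lemma sigma_ker (t : submod T) : carrier (ker (free_cover L_T)) (sigma (val t)).
Proof.
rewrite /carrier /= /ker_set /= cover_sigma -[RHS](linear0 (quotmod_pi T)).
by apply/quotmod_piP; rewrite subr0; exact: carrier_val.
Qed.

Definition sigmaT : {linear submod T -> Z1} :=
  @corestrict _ _ _ (ker (free_cover L_T)) (sigma \o val : {linear _ -> _}) sigma_ker.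

(** [xi] compares the standard resolution with the presentation of [L_T] by [T],
    read off in the first coordinate; the two lifts of the identity of [L_T]
    differ by a map that factors through [R^n], so [xi] inverts [sigmaT] up to a
    factor [1 + w] with [w] in the ideal of first coordinates. *)
Lemma comparison_ex : exists (xi : {linear Z1 -> R^o}) (w : R),
  [/\ forall z, firsts (xi z), firsts w &
      forall t, xi (sigmaT t) = val t 0 0 * (1 + w)].
Proof.
have [theta thetaP] := theta_linear_ex.
have thetaT (z : Z1) : carrier T (theta (val z)).
  rewrite -[theta _]subr0; apply/quotmod_piP.
  by rewrite thetaP ker_val linear0.
have lin_xi : linear (fun z : Z1 => theta (val z) 0 0 : R^o).
  by move=> a x y; rewrite !linearP !mxE.
pose w j := theta << ebase j >> - delta_mx 0 j.
have Tw j : carrier T (w j).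
  by apply/quotmod_piP; rewrite thetaP /free_cover /= free_extU.
exists (linear_of lin_xi), (\sum_j w j 0 j); split.
- by move=> z; exists (theta (val z)).
- apply: (@carrier_sum R R^o firsts_ideal) => j _; exact: firsts_coord.
move=> t; rewrite -[LHS]/(theta (sigma (val t)) 0 0) sigmaE linear_sum summxE.
rewrite mulrDr mulr1 mulr_sumr.
have -> : \sum_j val t 0 0 * w j 0 j = \sum_j val t 0 j * w j 0 0.
  apply: eq_bigr => j _.
  by rewrite (@T_prop_coord _ _ j (Tw j) (carrier_val t)) mulrC.
have -> : val t 0 0 = \sum_j val t 0 j * (delta_mx 0 j : 'rV[R]_n.+1) 0 0.
  by rewrite {1}[val t]row_sum_delta summxE; apply: eq_bigr => j _; rewrite mxE.
rewrite -big_split; apply: eq_bigr => j _ /=.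
by rewrite linearZ /= !mxE; ring.
Qed.

Variables (q : nat) (g : 'I_q -> submod T).
Hypothesis g_gen : forall t, carrier T t ->
  exists c : 'I_q -> R, t = \sum_i c i *: val (g i).

Definition gfirst : 'rV[R]_q := \row_i val (g i) 0 0.

(** The multiples of [gfirst] by elements of the total ring of fractions, a copy of
    the dual of the ideal of first coordinates. *)
Definition prop_set : set 'rV[R]_q :=
  [set u | forall i j, u 0 i * gfirst 0 j = u 0 j * gfirst 0 i].

Lemma prop_set0 : prop_set 0.
Proof. by move=> i j; rewrite !mxE !mul0r. Qed.

Lemma prop_setP a u v : prop_set u -> prop_set v -> prop_set (a *: u + v).
Proof.
move=> pu pv i j; have E k : (a *: u + v) 0 k = a * u 0 k + v 0 k.
  by rewrite !mxE.
by rewrite !E !mulrDl -!mulrA (pu i j) (pv i j).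
Qed.

Definition prop_submodule : submodule 'rV[R]_q := Submodule prop_set0 prop_setP.

Definition tor_test : lmodType R := quotmod prop_submodule.

Lemma gfirst_nonzerodiv a b : a *: gfirst = b *: gfirst -> a = b.
Proof.
move=> ab; have [t Tt treg] := T_reg; have [c et] := g_gen Tt.
have t0 : t 0 0 = \sum_i c i * gfirst 0 i.
  by rewrite et summxE; apply: eq_bigr => i _; rewrite !mxE.
apply/eqP; rewrite -subr_eq0; apply/eqP/treg; rewrite mulrC mulrBl t0.
rewrite !mulr_sumr -sumrB big1 // => i _.
have /rowP/(_ i) := ab; rewrite mxE [RHS]mxE => e.
by rewrite mulrCA e mulrCA subrr.
Qed.

Lemma tor_test_torsion_free : torsion_free tor_test.
Proof.
move=> s u sreg; rewrite -[u]quotmod_reprK -linearZ.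
rewrite -[0](linear0 (quotmod_pi prop_submodule)) => /quotmod_piP.
rewrite subr0 => psu; apply/quotmod_piP; rewrite subr0 => i j.
apply/eqP; rewrite -subr_eq0; apply/eqP/sreg; rewrite mulrBr !mulrA.
by have := psu i j; rewrite [X in X * _ = _]mxE [X in _ = X * _]mxE => ->; rewrite subrr.
Qed.

(** If [u = z gfirst] with [z] in the total ring of fractions, then multiplication by
    [z] is a functional on [firsts], with values in [firsts] by [T_trace]. *)
Lemma firsts_prop u b : prop_set u -> firsts b ->
  exists2 a, firsts a & b *: u = a *: gfirst.
Proof.
move=> pu [t Tt <-].
have /choice[c cP] (v : 'rV[R]_n.+1) : exists c : 'I_q -> R,
    carrier T v -> v = \sum_i c i *: val (g i).
  have [Tv|nTv] := pselect (carrier T v); last by exists (fun=> 0).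
  by have [c ec] := g_gen Tv; exists c.
have first v : carrier T v -> v 0 0 = \sum_i c v i * gfirst 0 i.
  by move=> /cP {1}->; rewrite summxE; apply: eq_bigr => i _; rewrite !mxE.
pose phi v := \sum_i c v i * u 0 i.
exists (phi t).
  apply: T_trace => // {Tt}t t' Tt Tt'; rewrite !first // /phi !mulr_suml.
  under eq_bigr => k _ do rewrite mulr_sumr.
  under [RHS]eq_bigr => k _ do rewrite mulr_sumr.
  rewrite exchange_big; apply: eq_bigr => i _; apply: eq_bigr => k _ /=.
  have e := pu i k; transitivity (c t' k * c t i * (u 0 i * gfirst 0 k)); first by ring.
  by rewrite e; ring.
apply/rowP => k; rewrite [LHS]mxE [RHS]mxE first // !mulr_suml.
apply: eq_bigr => i _.
by rewrite -!mulrA [gfirst _ _ * _]mulrC (pu k i).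
Qed.

(** Undoes the factor of the comparison lemma. *)
Lemma cancel_unit_part r w : firsts w -> firsts (r * (1 + w)) -> firsts r.
Proof.
move=> Xw Xrw; have -> : r = - r * w + r * (1 + w) by ring.
exact: firstsP.
Qed.

Lemma tor_bound_set0 : exists2 a, firsts a & (0 : 'rV[R]_q) = a *: gfirst.
Proof. by exists 0; [exact: firsts0 | rewrite scale0r]. Qed.

Lemma tor_bound_setP b u v : (exists2 a, firsts a & u = a *: gfirst) ->
  (exists2 a, firsts a & v = a *: gfirst) ->
  exists2 a, firsts a & b *: u + v = a *: gfirst.
Proof.
move=> [a Xa ->] [c Xc ->]; exists (b * a + c); first exact: firstsP.
by rewrite scalerDl scalerA.
Qed.

Definition tor_bound : submodule 'rV[R]_q :=
  @Submodule _ 'rV[R]_q [set u | _] tor_bound_set0 tor_bound_setP.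

(** The element [tau], the sum of the [sigmaT (g i) (x) e_i], is a 1-cycle because
    its boundary is [sum_j << ebase j >> (x) (g i j)_i], whose second factors are proportional to
    [gfirst].  The bilinear map [(f, u) |-> xi f * u], with values in [R^q] modulo
    the multiples of [gfirst] by first coordinates, shows that only first
    coordinates kill it. *)
Lemma Tor_detects_firsts r : ann (Tor 1 L_T tor_test) r -> firsts r.
Proof.
move/ann_homologyP => annr; have [xi [w [Xxi Xw xi_sigma]]] := comparison_ex.
pose pY : {linear 'rV[R]_q -> tor_test} := quotmod_pi prop_submodule.
pose rY (y : tor_test) : 'rV[R]_q :=
  repr (y : Quotient.quot (in_submodule prop_submodule)).
have rYK y : pY (rY y) = y by exact: quotmod_reprK.
have pYP u v : pY u = pY v <-> prop_set (u - v) := quotmod_piP prop_submodule u v.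
pose pW : {linear 'rV[R]_q -> quotmod tor_bound} := quotmod_pi tor_bound.
have pWprop (a : R) u : firsts a -> prop_set u -> pW (a *: u) = 0.
  move=> Xa pu; rewrite -(linear0 pW); apply/quotmod_piP; rewrite subr0.
  by have [b Xb ->] := firsts_prop pu Xa; exists b.
pose b (f : F1) y := pW ((xi (free_cover Z1 f) : R) *: rY y).
have b_l y : linear (b^~ y).
  move=> a f f'; rewrite /b linearP /= linearP.
  rewrite -[(_ + _ : R^o) *: rY y]/((a * xi _ + xi _ : R) *: rY y).
  by rewrite scalerDl -scalerA linearP.
have b_r f : linear (b f).
  move=> a y y'; rewrite /b -linearP; apply/eqP; rewrite -subr_eq0 -linearB.
  rewrite scalerA mulrC -scalerA -scalerDr -scalerBr; apply/eqP/pWprop => //.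
  by apply/pYP; rewrite linearP !rYK.
have [B BE] := tensor_lift_ex b_l b_r.
have B_bound t : B (tensor_map tor_test (resolution_d L_T 2) t) = 0.
  pose f : {linear tensor F2 tor_test -> _} :=
    B \o tensor_map tor_test (resolution_d L_T 2).
  apply: (@tensor_ext _ _ _ _ f \0) => u y; rewrite /f /=.
  rewrite tensor_mapE BE /b /= ker_val linear0.
  by rewrite (scale0r (rY y)) linear0.
pose tau : tensor F1 tor_test := \sum_i tmk << sigmaT (g i) >> (pY (delta_mx 0 i)).
have tau_cycle : tensor_map tor_test (resolution_d L_T 1) tau = 0.
  rewrite linear_sum.
  transitivity (\sum_i \sum_j
      tmk << ebase j >> (val (g i) 0 j *: pY (delta_mx 0 i)) : tensor F0 tor_test).
    apply: eq_bigr => i _; rewrite /= tensor_mapE /= /free_cover /= free_extU.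
    rewrite -[val _]/(sigma (val (g i))) sigmaE.
    pose h : {linear F0 -> tensor F0 tor_test} :=
      linear_of (fun a x x' => etrans (tmkDl _ x' (pY (delta_mx 0 i)))
        (congr1 (+%R^~ _) (tmkZl a x _))).
    rewrite -[LHS]/(h (\sum_j _)) linear_sum; apply: eq_bigr => j _.
    by rewrite linearZ /= tmkZr.
  rewrite exchange_big big1 // => j _ /=.
  have tD x y y' : tmk x (y + y') = tmk x y + tmk x y' :> tensor F0 tor_test.
    exact: tmkDr.
  have t0 x : tmk x 0 = 0 :> tensor F0 tor_test.
    by apply: (addrI (tmk x 0)); rewrite -tD !addr0.
  rewrite -(big_morph _ (tD << ebase j >>) (t0 _)).
  have -> : \sum_i val (g i) 0 j *: pY (delta_mx 0 i) = pY (\row_i val (g i) 0 j).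
    rewrite [in RHS](row_sum_delta (\row_i _)) linear_sum.
    by apply: eq_bigr => i _; rewrite linearZ /= mxE.
  suff -> : pY (\row_i val (g i) 0 j) = 0 by [].
  rewrite -(linear0 pY); apply/pYP; rewrite subr0 => i k; rewrite !mxE.
  by rewrite mulrC (T_prop_coord j (carrier_val _) (carrier_val _)) mulrC.
have [t et] := annr _ tau_cycle; have := B_bound t.
rewrite et linearZ /= linear_sum.
have -> : \sum_i B (tmk << sigmaT (g i) >> (pY (delta_mx 0 i)))
    = pW ((1 + w) *: gfirst).
  rewrite [in RHS](row_sum_delta gfirst) scaler_sumr linear_sum.
  apply: eq_bigr => i _; rewrite BE /b /free_cover /= free_extU xi_sigma.
  rewrite mxE scalerA mulrC; apply/eqP; rewrite -subr_eq0 -linearB /=.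
  rewrite -scalerBr -mulrC; apply/eqP/pWprop.
    by rewrite -xi_sigma.
  by apply/pYP; rewrite rYK.
rewrite -linearZ -(linear0 pW) => /(quotmod_piP tor_bound _ _).
rewrite subr0 => -[a Xa]; rewrite scalerA => /gfirst_nonzerodiv ra.
by apply: (cancel_unit_part Xw); rewrite ra.
Qed.

Lemma beta_linear : linear (fun u : 'rV[R]_q => \sum_i u 0 i * gfirst 0 i : R^o).
Proof.
move=> a u v; rewrite -[RHS]/(a * \sum_i u 0 i * gfirst 0 i + _).
rewrite mulr_sumr -big_split; apply: eq_bigr => i _ /=.
by rewrite [in LHS]mxE [in LHS]mxE mulrDl mulrA.
Qed.

Definition beta : {linear 'rV[R]_q -> R^o} := linear_of beta_linear.

Lemma betaE u : beta u = \sum_i u 0 i * gfirst 0 i.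
Proof. by []. Qed.

Definition ext_test : lmodType R := submod (ker beta).

Lemma beta_surj a : firsts a -> exists u, beta u = a.
Proof.
move=> [t Tt <-]; have [c ->] := g_gen Tt; exists (\row_i c i).
by rewrite betaE summxE; apply: eq_bigr => i _; rewrite !mxE.
Qed.

(** The extension class of [0 -> ext_test -> R^q -> firsts -> 0]; if [r] kills
    it, multiplication by [r] on the ideal of first coordinates factors through
    [R^q], and each coordinate of that map takes values in the ideal again. *)
Lemma Ext_detects_firsts r : ann (Ext 2 L_T ext_test) r -> firsts r.
Proof.
move/ann_homologyP => annr; have [xi [w [Xxi Xw xi_sigma]]] := comparison_ex.
move: sigmaT xi_sigma => sT xi_sigma.
have [k0 k0P] := choice (fun z => beta_surj (Xxi z)).
pose kappa : {linear F1 -> 'rV[R]_q} := free_ext k0.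
have kappaP f : beta (kappa f) = xi (free_cover Z1 f).
  apply: (@free_ext_ext _ _ _ (beta \o kappa : {linear _ -> _})
    (xi \o free_cover Z1 : {linear _ -> _})) => z.
  rewrite -[LHS]/(beta (kappa << z >>)) -[RHS]/(xi (free_cover Z1 << z >>)).
  have -> : kappa << z >> = k0 z by exact: free_extU.
  have -> : free_cover Z1 << z >> = z by exact: free_extU.
  exact: k0P.
have kappa_ker (s : Z2) : carrier (ker beta) ((kappa \o val) s).
  change (beta (kappa (val s)) = 0); rewrite kappaP ker_val; exact: linear0.
pose iota2 : {linear Z2 -> ext_test} :=
  @corestrict _ _ _ (ker beta) (kappa \o val : {linear _ -> _}) kappa_ker.
pose cocycle : {linear F2 -> ext_test} := iota2 \o free_cover Z2.
have cocycleP : in_submodule (Submodule (@hom_set0 R F2 ext_test) (@hom_setP R F2 ext_test))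
    (cocycle : F2 -> ext_test) by apply/asboolP => a x y; exact: linearP.
pose cl : Defs.hom F2 ext_test := Sub (cocycle : F2 -> ext_test) cocycleP.
have [|psi epsi] := annr cl.
  apply/val_inj/funext => u.
  rewrite -[LHS]/(iota2 (free_cover Z2 (val (free_cover (submod (ker (free_cover Z2))) u)))).
  by rewrite ker_val linear0.
have lpsi : linear (val psi : F1 -> ext_test) by exact/asboolP/(svalP psi).
pose Psi : {linear F1 -> ext_test} := linear_of lpsi.
have PsiP (s : Z2) : val (Psi (val s)) = r *: kappa (val s).
  have /(congr1 (fun f : Defs.hom F2 ext_test => val (val f << s >>))) := epsi.
  rewrite -[LHS]/(val (Psi (val (free_cover Z2 << s >>)))).
  rewrite -[RHS]/(r *: kappa (val (free_cover Z2 << s >>))).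
  by rewrite /free_cover /= free_extU.
pose alpha : {linear F1 -> 'rV[R]_q} := (r \*: kappa) \- (val \o Psi).
have alpha_ker f : free_cover Z1 f = 0 -> alpha f = 0.
  move=> cf; have kf : in_submodule (ker (free_cover Z1)) f by apply/asboolP.
  have := PsiP (Sub f kf : Z2); rewrite SubK => e.
  by rewrite -[LHS]/(r *: kappa f - val (Psi f)) e subrr.
have alpha_beta f : beta (alpha f) = r * xi (free_cover Z1 f).
  rewrite -[alpha _]/(r *: kappa _ - val (Psi _)) linearB ker_val subr0 linearZZ.
  by rewrite kappaP.
have cU z : free_cover Z1 << z >> = z by exact: free_extU.
have [abar abarE] := factor_free_cover alpha_ker.
have abar_beta t : beta (abar (sT t)) = r * (val t 0 0 * (1 + w)).
  by rewrite -abarE alpha_beta cU xi_sigma.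
clear - Xw T_prop T_reg T_trace abar_beta.
have abarP (t t' : submod T) :
    val t' 0 0 *: abar (sT t) = val t 0 0 *: abar (sT t').
  rewrite -!linearZ; congr (abar (sT _)); apply: val_inj.
  by rewrite !linearZ; apply: T_prop; exact: carrier_val.
have abarX (t : submod T) i : firsts (abar (sT t) 0 i).
  pose phi (v : 'rV[R]_n.+1) : R :=
    if insub v is Some u then abar (sT (u : submod T)) 0 i else 0.
  have phiE (u : submod T) : phi (val u) = abar (sT u) 0 i.
    by rewrite /phi valK.
  rewrite -phiE; apply: T_trace (carrier_val t) => v v' Tv Tv'.
  have [sv sv'] : in_submodule T v /\ in_submodule T v' by split; apply/asboolP.
  rewrite -[v](SubK (submod T) sv) -[v'](SubK (submod T) sv') !phiE.
  by have /rowP/(_ i) := abarP (Sub v sv) (Sub v' sv'); rewrite [LHS]mxE [RHS]mxE.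
have [t0 Tt0 treg] := T_reg; have st0 : in_submodule T t0 by apply/asboolP.
pose t : submod T := Sub t0 st0.
apply: (cancel_unit_part Xw).
have -> : r * (1 + w) = \sum_i abar (sT (g i)) 0 i.
  apply/eqP; rewrite -subr_eq0; apply/eqP/treg; rewrite mulrBr mulrCA.
  rewrite -(abar_beta t) betaE mulr_sumr; apply/eqP; rewrite subr_eq0.
  apply/eqP; apply: eq_bigr => i _; rewrite [gfirst _ _]mxE mulrC.
  by have /rowP/(_ i) := abarP t (g i); rewrite [LHS]mxE [RHS]mxE.
by apply: (@carrier_sum R R^o firsts_ideal) => i _; exact: abarX.
Qed.

Lemma ext_test_fg_torsion_free : finitely_generated ext_test /\ torsion_free ext_test.
Proof.
split; first by have [s Ks] := noetherian_rV_fg noeth (ker beta); exact: submod_fg Ks.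
move=> s u sreg su; apply: val_inj; apply/rowP => i; rewrite [RHS]mxE.
by apply: sreg; have /(congr1 val)/rowP/(_ i) := su; rewrite linearZ !mxE.
Qed.
End Detection.

(** * The conductor as an intersection of annihilators *)

Section PowerVectors.
Variables (R : comNzRingType) (y : total_frac R) (p : {poly R}).
Local Notation Q := (total_frac R).
Local Notation toQ := (@to_total_frac R).
Hypotheses (p_monic : p \is monic) (py0 : root (map_poly toQ p) y).
Local Notation n := (size p).

(** A copy of the ideal [(R : R[y])]; the powers beyond [n] follow from the equation
    of [y], by [all_powers].  As [n] is the size of [p], there is a coordinate for
    [y] itself. *)
Definition power_set : set 'rV[R]_n.+1 :=
  [set v | forall j : 'I_n.+1, toQ (v 0 j) = toQ (v 0 0) * y ^+ j].

Lemma power_set0 : power_set 0.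
Proof. by move=> j; rewrite !mxE rmorph0 mul0r. Qed.

Lemma power_setP a u v : power_set u -> power_set v -> power_set (a *: u + v).
Proof.
move=> pu pv j; have E k : (a *: u + v) 0 k = a * u 0 k + v 0 k by rewrite !mxE.
by rewrite !E !rmorphD !rmorphM /= pu pv mulrDl mulrA.
Qed.

Definition powers : submodule 'rV[R]_n.+1 := Submodule power_set0 power_setP.

Lemma all_powers a : (forall j, (j <= n)%N -> range toQ (toQ a * y ^+ j)) ->
  forall e, range toQ (toQ a * y ^+ e).
Proof.
move=> low e; elim/ltn_ind: e => e IHe.
have [/low//|lt_ne] := leqP e n.
have n_gt0 : (0 < n)%N by rewrite size_poly_gt0 monic_neq0.
have rel : y ^+ n.-1 = - \sum_(i < n.-1) toQ p`_i * y ^+ i.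
  apply/eqP; rewrite -addr_eq0; apply/eqP.
  move/eqP: py0; rewrite (@horner_coef_wide _ n) ?size_poly //.
  rewrite -(prednK n_gt0) big_ord_recr /= coef_map /= -lead_coefE (monicP p_monic).
  rewrite rmorph1 mul1r addrC => e0; apply: etrans e0; congr (_ + _).
  by apply: eq_bigr => i _; rewrite coef_map.
have le_e : (n.-1 <= e)%N by rewrite (leq_trans (leq_pred n)) // ltnW.
have /choice[c cP] (i : 'I_n.-1) : exists c, toQ c = toQ a * y ^+ (e - n.-1 + i).
  have [|c _ ec] := IHe (e - n.-1 + i)%N; last by exists c.
  by rewrite -{2}(subnK le_e) ltn_add2l; exact: ltn_ord.
exists (- \sum_(i < n.-1) p`_i * c i) => //.
rewrite rmorphN rmorph_sum -(subnK le_e) exprD rel !mulrN; congr (- _).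
rewrite !mulr_sumr; apply: eq_bigr => i _.
by rewrite rmorphM /= cP exprD; ring.
Qed.

Lemma powers_prop t t' : carrier powers t -> carrier powers t' ->
  t' 0 0 *: t = t 0 0 *: t'.
Proof.
move=> Tt Tt'; apply/rowP => j; rewrite !mxE; apply: (@to_total_frac_inj R).
by rewrite !rmorphM /= (Tt j) (Tt' j); ring.
Qed.

(** If [d] is a denominator of [y], the first coordinate is [d^n]. *)
Lemma powers_reg : exists2 t, carrier powers t & nonzerodiv_set R (t 0 0).
Proof.
have [b [d [dreg dy]]] := total_frac_ex y.
exists (\row_j (b ^+ j * d ^+ (n - j))).
  move=> j; rewrite !mxE subn0 mul1r rmorphM !rmorphXn /= -dy exprMn.
  have -> : toQ d ^+ n = toQ d ^+ j * toQ d ^+ (n - j).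
    by rewrite -exprD subnKC // -ltnS.
  ring.
rewrite mxE subn0 mul1r; elim: n => [|k IHk]; first exact: nonzerodiv1.
by rewrite exprS; exact: nonzerodivM.
Qed.

Lemma powers_sat s v : nonzerodiv_set R s -> carrier powers (s *: v) ->
  carrier powers v.
Proof.
move=> sreg Tsv j; apply: (total_frac_reg sreg); rewrite mulrA -!rmorphM /=.
have E k : (s *: v) 0 k = s * v 0 k by rewrite mxE.
by have := Tsv j; rewrite !E.
Qed.

(** The ideal of first coordinates is stable under multiplication by [y], so a
    functional on it, being multiplication by an element of [Q], maps it to
    itself. *)
Lemma powers_trace (phi : 'rV[R]_n.+1 -> R) :
  (forall t t', carrier powers t -> carrier powers t' ->
    t' 0 0 * phi t = t 0 0 * phi t') ->
  forall t, carrier powers t -> firsts powers (phi t).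
Proof.
move=> phiP t Tt; have [z Tz zreg] := powers_reg.
have t_all e : range toQ (toQ (t 0 0) * y ^+ e).
  apply: all_powers => j le_j; exists (t 0 (inord j)) => //.
  by rewrite Tt inordK.
have /choice[v vP] (j : 'I_n.+1) : exists v, carrier powers v /\
    toQ (v 0 0) = toQ (t 0 0) * y ^+ j.
  have /choice[a aP] (k : 'I_n.+1) : exists a,
      toQ a = toQ (t 0 0) * y ^+ (j + k).
    by have [a _ ea] := t_all (j + k)%N; exists a.
  exists (\row_k a k); split; last by rewrite mxE aP addn0.
  by move=> k; rewrite !mxE !aP addn0 exprD mulrA.
have phiv j : toQ (phi (v j)) = toQ (phi t) * y ^+ j.
  have [Tv ev] := vP j; apply: (total_frac_reg zreg).
  rewrite -rmorphM /= phiP // rmorphM /= ev.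
  by rewrite mulrAC -rmorphM /= -phiP // rmorphM /= mulrA.
have e0 : phi (v 0) = phi t.
  by apply: (@to_total_frac_inj R); rewrite phiv expr0 mulr1.
exists (\row_j phi (v j)); last by rewrite mxE.
by move=> j; rewrite !mxE e0 phiv.
Qed.

Lemma firsts_powers_mul r : firsts powers r -> range toQ (toQ r * y).
Proof.
move=> [t Tt <-]; have n_gt0 : (0 < n)%N by rewrite size_poly_gt0 monic_neq0.
exists (t 0 (inord 1)) => //.
by rewrite Tt inordK ?expr1 // ltnS.
Qed.

End PowerVectors.

Section MainTheorem.
Variables (R : comNzRingType) (m : ideal R).
Hypotheses (noeth : is_noetherian R) (loc_m : is_local m) (red : is_reduced R).
Hypothesis dim1 : krull_dim R 1.
Local Notation toQ := (@to_total_frac R).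

Lemma integral_test_modules y : integral_closure R y ->
  exists M N N' : lmodType R, [/\ CM0 M, CM0 N, CM0 N',
    forall r, ann (Tor 1 M N) r -> range toQ (toQ r * y) &
    forall r, ann (Ext 2 M N') r -> range toQ (toQ r * y)].
Proof.
move=> [p p_monic py0].
have [s Ts] := noetherian_rV_fg noeth (powers y p).
have sT (i : 'I_(size s)) : in_submodule (powers y p) s`_i.
  by apply/asboolP; rewrite Ts; apply/span_gen/mem_nth.
pose g (i : 'I_(size s)) : submod (powers y p) := Sub s`_i (sT i).
have g_gen t : carrier (powers y p) t ->
    exists c : 'I_(size s) -> R, t = \sum_i c i *: val (g i).
  by rewrite Ts => /span_seqP[c ->]; exists (fun i : 'I_(size s) => c (i : nat)).
have tP := @powers_prop R y p; have tR := @powers_reg R y p.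
have tS := @powers_sat R y p; have tT := powers_trace p_monic py0.
have CM := torsion_free_CM0 noeth loc_m red dim1.
have [fgE tfE] := ext_test_fg_torsion_free noeth g.
exists (L_T (powers y p)), (tor_test g), (ext_test g); split.
- by apply: CM; [exact: quotmod_fg_rV | exact: L_T_torsion_free].
- by apply: CM; [exact: quotmod_fg_rV | exact: tor_test_torsion_free].
- exact: CM.
- move=> r /(Tor_detects_firsts tP tR tT g_gen).
  exact: firsts_powers_mul.
- move=> r /(Ext_detects_firsts tP tR tT g_gen).
  exact: firsts_powers_mul.
Qed.

Lemma conductor_ann_Tor r : conductor R (toQ r) ->
  forall i (M N : lmodType R), (0 < i)%N -> CM0 M -> ann (Tor i M N) r.
Proof.
move=> cr [//|i] M N _ cmM; apply: scale_factors_ann_Tor.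
apply: (conductor_factor noeth loc_m red dim1) cr; first by case: cmM => [[]].
by apply: (@CM0_torsion_free R m).
Qed.

Lemma conductor_ann_Ext r : conductor R (toQ r) ->
  forall i (M N : lmodType R), (0 < i)%N -> CM0 M -> ann (Ext i M N) r.
Proof.
move=> cr [//|i] M N _ cmM; apply: scale_factors_ann_Ext.
apply: (conductor_factor noeth loc_m red dim1) cr; first by case: cmM => [[]].
by apply: (@CM0_torsion_free R m).
Qed.

End MainTheorem.

Theorem theorem1p2 (R : comNzRingType) (m : ideal R)
    (R_noetherian : is_noetherian R) (R_local : is_local m)
    (R_dim1 : krull_dim R 1) (completion_reduced : is_reduced (completion m)) :
  let tor_ann : set R :=
    [set r | forall (i : nat) (M N : lmodType R),
       (0 < i)%N -> CM0 M -> CM0 N -> ann (Tor i M N) r] in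
  let ext_ann : set R :=
    [set r | forall (i : nat) (M N : lmodType R),
       (0 < i)%N -> CM0 M -> CM0 N -> ann (Ext i M N) r] in
  let ext_ann2 : set R :=
    [set r | forall (i : nat) (M N : lmodType R),
       (1 < i)%N -> CM0 M -> CM0 N -> ann (Ext i M N) r] in
  [/\ conductor R = [set to_total_frac r | r in tor_ann],
      tor_ann = ext_ann & ext_ann = ext_ann2].
Proof.
move=> tor_ann ext_ann ext_ann2.
have red := completion_reduced_sub R_noetherian R_local completion_reduced.
pose cond : set R := [set r | conductor R (to_total_frac r)].
have tests := integral_test_modules R_noetherian R_local red R_dim1.
have torE : tor_ann = cond.
  rewrite predeqE => r; split=> [torr y /tests|cr i M N i_gt0 cmM _].
    by move=> [M [N [_ [cmM cmN _ det _]]]]; apply: det; exact: torr.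
  exact: (conductor_ann_Tor R_noetherian R_local red R_dim1).
have condE : cond `<=` ext_ann.
  move=> r cr i M N i_gt0 cmM _.
  exact: (conductor_ann_Ext R_noetherian R_local red R_dim1).
have ext2E : ext_ann2 `<=` cond.
  move=> r extr y /tests[M [_ [N [cmM _ cmN _ det]]]].
  by apply: det; exact: extr.
have ext12 : ext_ann `<=` ext_ann2.
  by move=> r extr i M N i_gt1; apply: extr; exact: ltnW.
split.
- rewrite torE predeqE => x; split=> [cx|[r cr <-] //].
  have [|r _ er] := cx 1; first exact: (integral1 (@to_total_frac R)).
  by exists r; rewrite ?er ?mulr1 // /cond /= er mulr1.
- by rewrite torE; apply/seteqP; split=> // r /ext12/ext2E.
- by apply/seteqP; split=> // r /ext2E/condE.
Qed.
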